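(* Let $k$ be a commutative ring, $A$ a unital cdg algebra over $k$, $M$ a unital cdg $A$-module, $C$ a counital dg coalgebra over $k$ and $\tau$ a solution of the Maurer-Cartan equation of the cdg algebra $\mathrm{Hom}^\bullet_k(C,A)$. The (contravariant) functor $$\mathsf{Com}\,C\to\mathrm{Mod}\,k,\qquad N\mapsto T_\tau\mathrm{MC}(S^{-1}\mathrm{Hom}^\bullet_k(N,M))$$ is representable. Denote by $M\otimes_\tau C$ (the bar construction over $C$ of $M$) a representative. Moreover, it can be chosen to yield a functor $$?\otimes_\tau C:\mathcal CA\to\mathsf{Com}\,C,\qquad M\mapsto M\otimes_\tau C$$ such that the isomorphism $(\mathsf{Com}\,C)(?,M\otimes_\tau C)\xrightarrow{\sim}T_\tau\mathrm{MC}(S^{-1}\mathrm{Hom}^\bullet_k(?,M))$ is natural in $M$.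
   Context: $k$ is a commutative associative unital ring; graded means $\mathbf Z$-graded; $\otimes=\otimes_k$; Koszul sign rule $(f\otimes g)(u\otimes v)=(-1)^{|g||u|}f(u)\otimes g(v)$; $(S^{-1}V)^p=V^{p-1}$. A unital cdg (curved dg) algebra is a unital graded associative $k$-algebra $A$ (multiplication $m_2$, unit $\eta_A:k\to A$) with $c\in A^2$ (curvature) and a degree $1$ map $d=m_1:A\to A$ with $d(c)=0$, $d(d(a))=ca-ac$, $d(ab)=d(a)b+(-1)^{|a|}a\,d(b)$. A unital (right) cdg $A$-module is a unital graded right $A$-module $M$ (action $m_2^M$) with a degree $1$ map $d_M$ with $d_M(ma)=d_M(m)a+(-1)^{|m|}m\,d(a)$ and $d_M(d_M(m))=-mc$. $\mathcal CA$ is the category of unital cdg $A$-modules, with degree $0$ $A$-linear maps commuting with the $d$'s. A counital dg coalgebra is $(C,d_C,\Delta,\eta)$, coassociative graded with counit $\eta:C\to k$ and square-zero degree $1$ coderivation $d_C$. $\mathsf{Com}\,C$ is the category of counital dg right $C$-comodules $(N,d_N,\Delta_N)$. $\mathrm{Hom}^\bullet_k(C,A)$ (graded module of homogeneous $k$-linear maps) is a cdg algebra with curvature $c\,\eta(-)$, predifferential $f\mapsto m_1f-(-1)^{|f|}fd_C$ and multiplication $(f,g)\mapsto m_2(f\otimes g)\Delta$; a solution of its Maurer-Cartan equation is a degree $1$ map $\tau:C\to A$ with $c\,\eta(-)+(m_1\tau+\tau d_C)+m_2(\tau\otimes\tau)\Delta=0$. $T_\tau\mathrm{MC}(S^{-1}\mathrm{Hom}^\bullet_k(N,M))$,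 the tangent space in $\tau$ to the Maurer-Cartan equation of the cdg module $S^{-1}\mathrm{Hom}^\bullet_k(N,M)$ over $\mathrm{Hom}^\bullet_k(C,A)$, identifies with the $k$-module of degree $0$ $k$-linear maps $f:N\to M$ with $$d_Mf-fd_N-m_2^M(f\otimes\tau)\Delta_N=0.$$ It is functorial in $N$ by precomposition and in $M$ by postcomposition. *)

(* Defs.v *)
From HB Require Import structures.
From mathcomp Require Import all_boot all_order all_algebra.
From mathcomp Require Import finmap.
From mathcomp Require Import boolp classical_sets functions cardinality fsbigop.

Set Implicit Arguments.
Unset Strict Implicit.
Unset Printing Implicit Defensive.
Import GRing.Theory.
Local Open Scope ring_scope.
Local Open Scope quotient_scope.

(* Tensor product of k-modules by generators and relations: finite formal     *)
(* sums of pairs (u, v), modulo the congruence generated by bilinearity.      *)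
(* Scalars and signs are absorbed in the first component.                     *)
Section TensorRelation.
Variables (k : comPzRingType) (U V : lmodType k).

Inductive tens_rel : seq (U * V) -> seq (U * V) -> Prop :=
| tens_refl s : tens_rel s s
| tens_sym s t : tens_rel s t -> tens_rel t s
| tens_trans s t r : tens_rel s t -> tens_rel t r -> tens_rel s r
| tens_cat s s' t t' :
    tens_rel s s' -> tens_rel t t' -> tens_rel (s ++ t) (s' ++ t')
| tens_catC s t : tens_rel (s ++ t) (t ++ s)
| tens_zero v : tens_rel [:: (0, v)] [::]
| tens_addl u u' v : tens_rel [:: (u + u', v)] [:: (u, v); (u', v)]
| tens_addr u v v' : tens_rel [:: (u, v + v')] [:: (u, v); (u, v')]
| tens_scale a u v : tens_rel [:: (a *: u, v)] [:: (u, a *: v)].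

Lemma tens_cons p s t : tens_rel s t -> tens_rel (p :: s) (p :: t).
Proof. by apply: (@tens_cat [:: p] [:: p]); exact: tens_refl. Qed.

Lemma tens_mid p s t : tens_rel (s ++ p :: t) (p :: s ++ t).
Proof.
rewrite -cat1s -[p :: s ++ t]/([:: p] ++ s ++ t) !catA.
by apply: tens_cat; [exact: tens_catC|exact: tens_refl].
Qed.

Definition tens_relb (s t : seq (U * V)) : bool := `[< tens_rel s t >].

Lemma tens_relb_refl : reflexive tens_relb.
Proof. by move=> s; apply/asboolP; exact: tens_refl. Qed.

Lemma tens_relb_sym : symmetric tens_relb.
Proof. by move=> s t; apply/asboolP/asboolP; exact: tens_sym. Qed.

Lemma tens_relb_trans : transitive tens_relb.
Proof.
by move=> t s r /asboolP st /asboolP tr; apply/asboolP; exact: tens_trans tr.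
Qed.

Canonical tens_equiv :=
  EquivRel tens_relb tens_relb_refl tens_relb_sym tens_relb_trans.

Definition tens := {eq_quot tens_equiv}.
HB.instance Definition _ := Choice.copy tens {eq_quot tens_equiv}.
HB.instance Definition _ := Quotient.copy tens {eq_quot tens_equiv}.

Lemma tens_pi_eq s t : tens_rel s t -> \pi_tens s = \pi_tens t.
Proof. by move=> st; apply/eqmodP/asboolP. Qed.

Lemma tens_repr s : tens_rel (repr (\pi_tens s)) s.
Proof.
suff /eqmodP/asboolP : \pi_tens (repr (\pi_tens s)) = \pi_tens s by [].
exact: reprK.
Qed.

Lemma tens_map_rel (f : U -> U) : linear f -> forall s t, tens_rel s t ->
  tens_rel [seq (f x.1, x.2) | x <- s] [seq (f x.1, x.2) | x <- t].
Proof.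
move=> fl s t.
have fD u u' : f (u + u') = f u + f u' by have := fl 1 u u'; rewrite !scale1r.
have f0 : f 0 = 0 by apply: (addIr (f 0)); rewrite -fD !add0r.
have fZ a u : f (a *: u) = a *: f u by have := fl a u 0; rewrite f0 !addr0.
elim=> [{}s|{}s {}t _ h|{}s {}t r _ h1 _ h2|s1 s1' t1 t1' _ h1 _ h2|s1 t1|v
  |u u' v|u v v'|a u v] /=.
- exact: tens_refl.
- exact: tens_sym.
- exact: tens_trans h2.
- by rewrite !map_cat; exact: tens_cat.
- by rewrite !map_cat; exact: tens_catC.
- by rewrite f0; exact: tens_zero.
- by rewrite fD; exact: tens_addl.
- exact: tens_addr.
- by rewrite fZ; exact: tens_scale.
Qed.

Definition tens_zeroe : tens := \pi_tens [::].
Definition tens_add (x y : tens) : tens := \pi_tens (repr x ++ repr y).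
Definition tens_opp (x : tens) : tens :=
  \pi_tens [seq (- p.1, p.2) | p <- repr x].
Definition tens_scal (a : k) (x : tens) : tens :=
  \pi_tens [seq (a *: p.1, p.2) | p <- repr x].

Lemma tens_addE s t : tens_add (\pi s) (\pi t) = \pi_tens (s ++ t).
Proof. by apply: tens_pi_eq; apply: tens_cat; exact: tens_repr. Qed.

Lemma scale_lin (a : k) : linear (fun u : U => a *: u).
Proof. by move=> b u v; rewrite scalerDr !scalerA mulrC. Qed.

Lemma opp_lin : linear (fun u : U => - u).
Proof. by move=> b u v; rewrite opprD scalerN. Qed.

Lemma tens_oppE s : tens_opp (\pi s) = \pi_tens [seq (- p.1, p.2) | p <- s].
Proof. by apply: tens_pi_eq; apply: (tens_map_rel opp_lin); exact: tens_repr. Qed.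

Lemma tens_scalE a s :
  tens_scal a (\pi s) = \pi_tens [seq (a *: p.1, p.2) | p <- s].
Proof.
by apply: tens_pi_eq; apply: (tens_map_rel (scale_lin a)); exact: tens_repr.
Qed.

Lemma tens_addA : associative tens_add.
Proof.
by elim/quotW=> x; elim/quotW=> y; elim/quotW=> z; rewrite !tens_addE catA.
Qed.

Lemma tens_addC : commutative tens_add.
Proof.
elim/quotW=> x; elim/quotW=> y; rewrite !tens_addE; apply: tens_pi_eq.
exact: tens_catC.
Qed.

Lemma tens_add0 : left_id tens_zeroe tens_add.
Proof. by elim/quotW=> x; rewrite /tens_zeroe !tens_addE. Qed.

Lemma tens_addN : left_inverse tens_zeroe tens_opp tens_add.
Proof.
elim/quotW=> x; rewrite tens_oppE tens_addE; apply: tens_pi_eq.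
elim: x => [|[u v] s IH] /=; first exact: tens_refl.
apply: (@tens_trans _
  ([:: (- u, v); (u, v)] ++ ([seq (- p.1, p.2) | p <- s] ++ s))).
  by apply: tens_cons; exact: tens_mid.
apply: (@tens_cat _ [::] _ [::]) => //.
apply: (@tens_trans _ [:: (- u + u, v)]).
  by apply: tens_sym; exact: tens_addl.
by rewrite addNr; exact: tens_zero.
Qed.

HB.instance Definition _ := GRing.isZmodule.Build tens
  tens_addA tens_addC tens_add0 tens_addN.

Lemma tens_scalA a b x : tens_scal a (tens_scal b x) = tens_scal (a * b) x.
Proof.
elim/quotW: x => x; rewrite !tens_scalE -map_comp.
by congr (\pi_tens _); apply: eq_map => p /=; rewrite scalerA.
Qed.

Lemma tens_scal1 : left_id 1 tens_scal.
Proof.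
elim/quotW=> x; rewrite tens_scalE; congr (\pi_tens _).
by rewrite -[RHS]map_id; apply: eq_map => -[u v] /=; rewrite scale1r.
Qed.

Lemma tens_scalDr : right_distributive tens_scal +%R.
Proof.
move=> a; elim/quotW=> x; elim/quotW=> y; rewrite /GRing.add /=.
by rewrite tens_addE !tens_scalE tens_addE map_cat.
Qed.

Lemma tens_scalDl x : {morph tens_scal^~ x : a b / a + b}.
Proof.
move=> a b; elim/quotW: x => x; rewrite [in RHS]/GRing.add /=.
rewrite !tens_scalE tens_addE; apply: tens_pi_eq.
elim: x => [|[u v] s IH] /=; first exact: tens_refl.
set f := [seq (a *: _, _) | _ <- s] in IH *.
set g := [seq (b *: _, _) | _ <- s] in IH *.
apply: (@tens_trans _ ([:: (a *: u, v); (b *: u, v)] ++ (f ++ g))).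
  rewrite -[X in tens_rel X _]cat1s; apply: tens_cat => //.
  by rewrite scalerDl; exact: tens_addl.
by apply: tens_cons; apply: tens_sym; exact: tens_mid.
Qed.

HB.instance Definition _ := GRing.Zmodule_isLmodule.Build k tens
  tens_scalA tens_scal1 tens_scalDr tens_scalDl.

Definition tpure (u : U) (v : V) : tens := \pi_tens [:: (u, v)].

(* The map induced by b; meaningful only when b is bilinear (see tens_liftE). *)
Definition tens_lift (W : zmodType) (b : U -> V -> W) (x : tens) : W :=
  \sum_(p <- repr x) b p.1 p.2.

Definition bilin (W : lmodType k) (b : U -> V -> W) : Prop :=
  (forall v, linear (b^~ v)) /\ (forall u, linear (b u)).

End TensorRelation.

Section TensorTheory.
Variables (k : comPzRingType) (U V : lmodType k).
Local Notation tens := (tens U V).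

Lemma lin0 (W W' : lmodType k) (f : W -> W') : linear f -> f 0 = 0.
Proof. by move=> fl; have := fl (-1) 0 0; rewrite scaler0 addr0 scaleN1r addNr. Qed.

Lemma linD (W W' : lmodType k) (f : W -> W') : linear f ->
  {morph f : x y / x + y}.
Proof. by move=> fl x y; have := fl 1 x y; rewrite !scale1r. Qed.

Lemma linZ (W W' : lmodType k) (f : W -> W') : linear f ->
  forall a x, f (a *: x) = a *: f x.
Proof. by move=> fl a x; have := fl a x 0; rewrite (lin0 fl) !addr0. Qed.

Lemma tens_lift_pi (W : lmodType k) (b : U -> V -> W) (s : seq (U * V)) :
  bilin b -> tens_lift b (\pi_tens s) = \sum_(p <- s) b p.1 p.2.
Proof.
move=> [bl br]; rewrite /tens_lift; move: (repr _) (tens_repr s) => r.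
elim=> {r s} //=.
- by move=> s t r _ -> _ ->.
- by move=> s1 s2 t1 t2 _ h1 _ h2; rewrite !big_cat /= h1 h2.
- by move=> s1 t1; rewrite !big_cat /= addrC.
- by move=> v; rewrite big_seq1 big_nil (lin0 (bl v)).
- by move=> u u' v; rewrite !big_cons big_nil /= !addr0 (linD (bl v)).
- by move=> u v v'; rewrite !big_cons big_nil /= !addr0 (linD (br u)).
- by move=> a u v; rewrite !big_seq1 /= (linZ (bl v)) (linZ (br u)).
Qed.

Lemma tens_addpi (s t : seq (U * V)) :
  \pi_tens s + \pi_tens t = \pi_tens (s ++ t) :> tens.
Proof. exact: tens_addE. Qed.

Lemma tens_scalpi a (s : seq (U * V)) :
  a *: \pi_tens s = \pi_tens [seq (a *: p.1, p.2) | p <- s] :> tens.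
Proof. exact: tens_scalE. Qed.

Lemma tens_liftE (W : lmodType k) (b : U -> V -> W) u v :
  bilin b -> tens_lift b (tpure u v) = b u v.
Proof. by move=> bb; rewrite tens_lift_pi// big_seq1. Qed.

Lemma tens_lift_linear (W : lmodType k) (b : U -> V -> W) :
  bilin b -> linear (tens_lift b).
Proof.
move=> bb a; elim/quotW=> x; elim/quotW=> y.
rewrite tens_scalpi tens_addpi !tens_lift_pi// big_cat/= big_map scaler_sumr.
congr (_ + _); apply: eq_bigr => p _ /=.
by rewrite (linZ (bb.1 p.2)).
Qed.

Lemma tpure_bilin : bilin (@tpure k U V).
Proof.
split=> [v|u] a x y; rewrite /tpure.
- rewrite tens_scalpi tens_addpi /=; apply: tens_pi_eq; exact: tens_addl.
- rewrite tens_scalpi tens_addpi /=; apply: tens_pi_eq.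
  apply: tens_trans (tens_addr _ _ _) _.
  rewrite -[X in tens_rel X _]cat1s -[X in tens_rel _ X]cat1s.
  by apply: tens_cat; [apply: tens_sym; exact: tens_scale|exact: tens_refl].
Qed.

Lemma tens_ind (P : tens -> Prop) : P 0 -> (forall x y, P x -> P y -> P (x + y)) ->
  (forall u v, P (tpure u v)) -> forall x, P x.
Proof.
move=> P0 PD Pp x; rewrite -[x]reprK; elim: (repr x) => [//|[u v] s IH].
by rewrite -cat1s -tens_addpi; apply: PD => //; exact: Pp.
Qed.

Lemma tens_ext (W : lmodType k) (f g : tens -> W) : linear f -> linear g ->
  (forall u v, f (tpure u v) = g (tpure u v)) -> f =1 g.
Proof.
move=> fl gl fg; apply: tens_ind => //; first by rewrite !lin0.
by move=> x y fx fy; rewrite !linD// fx fy.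
Qed.

End TensorTheory.

(* (f (x) g)(u (x) v) = f u (x) g v, without Koszul sign                      *)
Definition tensmap (k : comPzRingType) (U V U' V' : lmodType k)
    (f : U -> U') (g : V -> V') : tens U V -> tens U' V' :=
  tens_lift (fun u v => tpure (f u) (g v)).

Definition tassoc (k : comPzRingType) (U V W : lmodType k) :
    tens (tens U V) W -> tens U (tens V W) :=
  tens_lift (fun x w => tens_lift (fun u v => tpure u (tpure v w)) x).

Lemma tensmap_bilin (k : comPzRingType) (U V U' V' : lmodType k)
    (f : U -> U') (g : V -> V') : linear f -> linear g ->
  bilin (fun u v => tpure (f u) (g v)).
Proof.
move=> fl gl; split=> [v|u] a x y.
- by rewrite fl (tpure_bilin _ _).1.
- by rewrite gl (tpure_bilin _ _).2.
Qed.

Lemma tensmapE (k : comPzRingType) (U V U' V' : lmodType k)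
    (f : U -> U') (g : V -> V') u v : linear f -> linear g ->
  tensmap f g (tpure u v) = tpure (f u) (g v).
Proof. by move=> fl gl; rewrite /tensmap tens_liftE//; exact: tensmap_bilin. Qed.

Lemma tensmap_linear (k : comPzRingType) (U V U' V' : lmodType k)
    (f : U -> U') (g : V -> V') : linear f -> linear g -> linear (tensmap f g).
Proof. by move=> fl gl; apply: tens_lift_linear; exact: tensmap_bilin. Qed.

Lemma linS (k : comPzRingType) (W W' : lmodType k) (f : W -> W') : linear f ->
  forall (I : Type) (r : seq I) (F : I -> W),
    f (\sum_(i <- r) F i) = \sum_(i <- r) f (F i).
Proof.
move=> fl I r F; elim: r => [|i r IH]; first by rewrite !big_nil (lin0 fl).
by rewrite !big_cons (linD fl) IH.
Qed.

Section Grading.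
Local Open Scope classical_set_scope.

(* A Z-grading V = \bigoplus_p V^p, given by the projections V -> V^p `<=` V. *)
Record grading (k : comPzRingType) (V : lmodType k) := Grading {
  gpr : int -> {linear V -> V};
  gpr_idem : forall i j x, gpr i (gpr j x) = if i == j then gpr j x else 0;
  gpr_fin : forall x, finite_set [set i | gpr i x != 0];
  gpr_sum : forall x, x = \sum_(i \in [set: int]) gpr i x
}.

(* x \in V^p *)
Definition homog (k : comPzRingType) (V : lmodType k) (G : grading V)
  (p : int) (x : V) : Prop := gpr G p x = x.

Definition homdeg (k : comPzRingType) (V W : lmodType k)
    (G : grading V) (H : grading W) (n : int) (f : V -> W) : Prop :=
  forall p x, homog G p x -> homog H (p + n) (f x).

Definition ksign (k : comPzRingType) (p : int) : k := (-1) ^+ `|p|%N.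

(* The k-linear map x |-> (-1)^(q |x|) x. *)
Definition gsgn (k : comPzRingType) (V : lmodType k) (G : grading V)
  (q : int) (x : V) : V := \sum_(p \in [set: int]) ksign k (p * q) *: gpr G p x.

(* f (x) g with the Koszul sign, for g of degree q:                           *)
(*   (f (x) g)(u (x) v) = (-1)^(q |u|) f u (x) g v  (see ktensE).             *)
Definition ktens (k : comPzRingType) (U V U' V' : lmodType k) (G : grading U)
    (q : int) (f : U -> U') (g : V -> V') : tens U V -> tens U' V' :=
  tensmap (f \o gsgn G q) g.

Section FiniteSums.
Variable W : zmodType.
Implicit Types (F : int -> W) (A B : {fset int}).

Lemma fsumE A F : (forall p : int, p \notin A -> F p = 0) ->
  \sum_(p \in [set: int]) F p = \sum_(p <- A) F p.
Proof. by move=> h; rewrite (fsbigTE A). Qed.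

Lemma fsumD A B F F' : (forall p : int, p \notin A -> F p = 0) ->
  (forall p : int, p \notin B -> F' p = 0) ->
  \sum_(p \in [set: int]) (F p + F' p) =
  \sum_(p \in [set: int]) F p + \sum_(p \in [set: int]) F' p.
Proof.
move=> hF hF'; have hA p : p \notin (A `|` B)%fset -> F p = 0.
  by rewrite in_fsetU negb_or => /andP[/hF].
have hB p : p \notin (A `|` B)%fset -> F' p = 0.
  by rewrite in_fsetU negb_or => /andP[_ /hF'].
rewrite (fsumE hA) (fsumE hB) (@fsumE (A `|` B)%fset) ?big_split// => p pn.
by rewrite hA// hB// addr0.
Qed.

End FiniteSums.

Section GradingTheory.
Variables (k : comPzRingType) (V : lmodType k) (G : grading V).

Lemma gpr_supp x :
  exists A : {fset int}, forall p : int, p \notin A -> gpr G p x = 0.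
Proof.
exists (fset_set [set i | gpr G i x != 0]) => p.
rewrite in_fset_set; last exact: gpr_fin.
by rewrite notin_setE /= => /negP/negPn/eqP.
Qed.

Lemma gsgnE q p x : homog G p x -> gsgn G q x = ksign k (p * q) *: x.
Proof.
move=> xp; rewrite /gsgn (@fsumE _ [fset p]%fset) ?big_seq_fset1 ?xp// => r.
by rewrite in_fset1 -xp gpr_idem => /negbTE ->; rewrite scaler0.
Qed.

Lemma gsgn_linear q : linear (gsgn G q).
Proof.
move=> a x y; have [A hA] := gpr_supp x; have [B hB] := gpr_supp y.
have hAB (p : int) : p \notin (A `|` B)%fset -> gpr G p x = 0 /\ gpr G p y = 0.
  by rewrite in_fsetU negb_or => /andP[/hA -> /hB ->].
rewrite /gsgn !(@fsumE _ (A `|` B)%fset) ?scaler_sumr -?big_split/=.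
- apply: eq_bigr => p _.
  by rewrite linearP scalerDr !scalerA [ksign _ _ * _]mulrC.
- by move=> p /hAB[_ ->]; rewrite scaler0.
- by move=> p /hAB[-> _]; rewrite scaler0.
- by move=> p /hAB[xp yp]; rewrite linearP xp yp addr0 !scaler0.
Qed.

End GradingTheory.

Lemma ktensE (k : comPzRingType) (U V U' V' : lmodType k) (G : grading U)
    (q : int) (f : U -> U') (g : V -> V') (p : int) (u : U) (v : V) :
  linear f -> linear g -> homog G p u ->
  ktens G q f g (tpure u v) = ksign k (p * q) *: tpure (f u) (g v).
Proof.
move=> fl gl up; rewrite /ktens tensmapE//=.
  by rewrite (gsgnE q up) (linZ fl) (linZ ((tpure_bilin _ _).1 _)).
by move=> a x y /=; rewrite gsgn_linear fl.
Qed.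

Section TensorGrading.
Variables (k : comPzRingType) (U V : lmodType k).
Variables (G : grading U) (H : grading V).

(* (U (x) V)^n = \bigoplus_(p + q = n) U^p (x) V^q                            *)
Definition tens_pr (n : int) (t : tens U V) : tens U V :=
  \sum_(p \in [set: int]) tensmap (gpr G p) (gpr H (n - p)) t.

Let Pl n p : linear (tensmap (gpr G p) (gpr H (n - p))).
Proof. by apply: tensmap_linear; exact: linearP. Qed.

Lemma tens_pr_supp t : exists A : {fset int}, forall n (p : int), p \notin A ->
  tensmap (gpr G p) (gpr H (n - p)) t = 0.
Proof.
elim/tens_ind: t => [|x y [A hA] [B hB]|u v].
- by exists fset0 => n p _; rewrite (lin0 (Pl n p)).
- exists (A `|` B)%fset => n p; rewrite in_fsetU negb_or => /andP[pA pB].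
  by rewrite (linD (Pl n p)) hA// hB// addr0.
have [A hA] := gpr_supp G u; exists A => n p pA.
rewrite tensmapE; [|exact: linearP|exact: linearP].
by rewrite hA// (lin0 ((tpure_bilin _ _).1 _)).
Qed.

Lemma tens_pr_linear n : linear (tens_pr n).
Proof.
move=> a x y; have [A hA] := tens_pr_supp x; have [B hB] := tens_pr_supp y.
have hAB (p : int) : p \notin (A `|` B)%fset ->
    tensmap (gpr G p) (gpr H (n - p)) x = 0 /\
    tensmap (gpr G p) (gpr H (n - p)) y = 0.
  by rewrite in_fsetU negb_or => /andP[/hA -> /hB ->].
rewrite /tens_pr !(@fsumE _ (A `|` B)%fset) ?scaler_sumr -?big_split/=.
- by apply: eq_bigr => p _; rewrite Pl.
- by move=> p /hAB[].
- by move=> p /hAB[].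
- by move=> p /hAB[xp yp]; rewrite Pl xp yp scaler0 addr0.
Qed.

HB.instance Definition _ n := GRing.isLinear.Build k (tens U V) (tens U V) _
  (tens_pr n) (tens_pr_linear n).

Lemma tens_pr_pure (A : {fset int}) n u v :
  (forall p : int, p \notin A -> gpr G p u = 0) ->
  tens_pr n (tpure u v) = \sum_(p <- A) tpure (gpr G p u) (gpr H (n - p) v).
Proof.
move=> hA; rewrite /tens_pr (@fsumE _ A) => [|p pA].
  by apply: eq_bigr => p _; rewrite tensmapE//; exact: linearP.
rewrite tensmapE; [|exact: linearP|exact: linearP].
by rewrite hA// (lin0 ((tpure_bilin _ _).1 _)).
Qed.

Lemma tens_pr_idem i j t :
  tens_pr i (tens_pr j t) = if i == j then tens_pr j t else 0.
Proof.
elim/tens_ind: t => [|x y hx hy|u v].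
- by rewrite !linear0; case: ifP.
- by rewrite !linearD /= hx hy; case: ifP => // _; rewrite addr0.
have [A hA] := gpr_supp G u; rewrite (tens_pr_pure _ _ hA) linear_sum /=.
transitivity (\sum_(p <- A)
    if i == j then tpure (gpr G p u) (gpr H (j - p) v) else 0); last first.
  by case: ifP => // _; rewrite big1.
apply: eq_bigr => p _; rewrite (@tens_pr_pure [fset p]%fset) => [|r].
  rewrite big_seq_fset1 !gpr_idem eqxx (inj_eq (addIr _)).
  by case: ifP => // _; rewrite (lin0 ((tpure_bilin _ _).2 _)).
by rewrite in_fset1 gpr_idem => /negbTE ->.
Qed.

Lemma tens_pr_fset t :
  exists B : {fset int}, forall n : int, n \notin B -> tens_pr n t = 0.
Proof.
elim/tens_ind: t => [|x y [A hA] [B hB]|u v].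
- by exists fset0 => n _; rewrite linear0.
- exists (A `|` B)%fset => n; rewrite in_fsetU negb_or => /andP[nA nB].
  by rewrite linearD /= hA// hB// addr0.
have [A hA] := gpr_supp G u; have [B hB] := gpr_supp H v.
exists [fset (p.1 + p.2)%R | p in (A `*` B)]%fset => n nAB.
rewrite (tens_pr_pure _ _ hA) big_seq big1// => p pA.
rewrite hB ?(lin0 ((tpure_bilin _ _).2 _))//.
apply: contra nAB => npB; apply/imfsetP; exists (p, n - p) => /=.
  by rewrite in_fsetM /= pA.
by rewrite addrC subrK.
Qed.

Lemma tens_pr_fin t : finite_set [set n | tens_pr n t != 0].
Proof.
have [B hB] := tens_pr_fset t; apply: (finite_subfset B) => n /=.
by apply: contraNT => /hB ->.
Qed.

Lemma tens_pr_sum t : t = \sum_(n \in [set: int]) tens_pr n t.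
Proof.
elim/tens_ind: t => [|x y hx hy|u v].
- by rewrite fsbig1// => n _; rewrite linear0.
- have [A hA] := tens_pr_fset x; have [B hB] := tens_pr_fset y.
  rewrite [in LHS]hx [in LHS]hy -(fsumD hA hB); apply: eq_fsbigr => n _.
  by rewrite linearD.
have [A hA] := gpr_supp G u; have [B hB] := gpr_supp H v.
set D := [fset (p.1 + p.2)%R | p in (A `*` B)]%fset.
have hD n p : p \in A -> n \notin D -> gpr H (n - p) v = 0.
  move=> pA nD; rewrite hB//; apply: contra nD => npB.
  apply/imfsetP; exists (p, n - p) => /=; first by rewrite in_fsetM /= pA.
  by rewrite addrC subrK.
rewrite (@fsumE _ D) => [|n nD]; last first.
  rewrite (tens_pr_pure _ _ hA) big_seq big1// => p pA.
  by rewrite (hD n p)// (lin0 ((tpure_bilin _ _).2 _)).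
under eq_bigr do rewrite (tens_pr_pure _ _ hA).
rewrite exchange_big /= [X in tpure X _](gpr_sum G u) (fsumE hA).
rewrite (linS ((tpure_bilin _ _).1 _)) big_seq [RHS]big_seq.
apply: eq_bigr => p pA; rewrite -(linS ((tpure_bilin _ _).2 _)); congr tpure.
rewrite -(@fsumE _ D) => [|n nD]; last exact: hD.
rewrite [LHS](gpr_sum H v) (reindex_fsbigT (fun n : int => n - p))//.
by exists (fun n => n + p) => n; rewrite ?subrK ?addrK.
Qed.

Definition tens_grading : grading (tens U V) :=
  @Grading k (tens U V) (fun n => tens_pr n : {linear tens U V -> tens U V})
    tens_pr_idem tens_pr_fin tens_pr_sum.

End TensorGrading.
End Grading.

Section Structures.
Variable k : comPzRingType.

(* The product is an explicit bilinear operation on a k-module because the    *)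
(* library's algType excludes the zero algebra.                               *)
Record cdgAlg := CdgAlg {
  cdga_mod :> lmodType k;
  cdga_gr : grading cdga_mod;
  cdga_mul : cdga_mod -> cdga_mod -> cdga_mod;
  cdga_one : cdga_mod;
  cdga_d : {linear cdga_mod -> cdga_mod};
  cdga_c : cdga_mod;
  cdga_mul_bilin : bilin cdga_mul;
  cdga_mulA : associative cdga_mul;
  cdga_mul1 : left_id cdga_one cdga_mul;
  cdga_mulr1 : right_id cdga_one cdga_mul;
  cdga_one_deg : homog cdga_gr 0 cdga_one;
  cdga_mul_deg : forall p q a b, homog cdga_gr p a -> homog cdga_gr q b ->
    homog cdga_gr (p + q) (cdga_mul a b);
  cdga_d_deg : homdeg cdga_gr cdga_gr 1 cdga_d;
  cdga_c_deg : homog cdga_gr 2 cdga_c;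
  cdga_dc : cdga_d cdga_c = 0;
  cdga_dd : forall a, cdga_d (cdga_d a) = cdga_mul cdga_c a - cdga_mul a cdga_c;
  cdga_leibniz : forall p a b, homog cdga_gr p a ->
    cdga_d (cdga_mul a b) =
      cdga_mul (cdga_d a) b + ksign k p *: cdga_mul a (cdga_d b)
}.

(* Right modules: cdgm_act m a stands for m a.                                *)
Record cdgMod (A : cdgAlg) := CdgMod {
  cdgm_mod :> lmodType k;
  cdgm_gr : grading cdgm_mod;
  cdgm_d : {linear cdgm_mod -> cdgm_mod};
  cdgm_act : cdgm_mod -> A -> cdgm_mod;
  cdgm_act_bilin : bilin cdgm_act;
  cdgm_act1 : forall m, cdgm_act m (cdga_one A) = m;
  cdgm_actA : forall m a b,
    cdgm_act (cdgm_act m a) b = cdgm_act m (cdga_mul a b);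
  cdgm_act_deg : forall p q m a, homog cdgm_gr p m -> homog (cdga_gr A) q a ->
    homog cdgm_gr (p + q) (cdgm_act m a);
  cdgm_d_deg : homdeg cdgm_gr cdgm_gr 1 cdgm_d;
  cdgm_leibniz : forall p m a, homog cdgm_gr p m ->
    cdgm_d (cdgm_act m a) =
      cdgm_act (cdgm_d m) a + ksign k p *: cdgm_act m (cdga_d A a);
  cdgm_dd : forall m, cdgm_d (cdgm_d m) = - cdgm_act m (cdga_c A)
}.

Record dgCoalg := DgCoalg {
  dgc_mod :> lmodType k;
  dgc_gr : grading dgc_mod;
  dgc_d : {linear dgc_mod -> dgc_mod};
  dgc_comul : {linear dgc_mod -> tens dgc_mod dgc_mod};
  dgc_counit : {linear dgc_mod -> k^o};
  dgc_comul_deg : homdeg dgc_gr (tens_grading dgc_gr dgc_gr) 0 dgc_comul;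
  (* k sits in degree 0 *)
  dgc_counit_deg : forall p c, homog dgc_gr p c -> p != 0 -> dgc_counit c = 0;
  dgc_coassoc : forall c, tassoc (tensmap dgc_comul idfun (dgc_comul c)) =
    tensmap idfun dgc_comul (dgc_comul c);
  dgc_counitl : forall c,
    tens_lift (fun x y => dgc_counit x *: y) (dgc_comul c) = c;
  dgc_counitr : forall c,
    tens_lift (fun x y => dgc_counit y *: x) (dgc_comul c) = c;
  dgc_d_deg : homdeg dgc_gr dgc_gr 1 dgc_d;
  dgc_dd : forall c, dgc_d (dgc_d c) = 0;
  dgc_coder : forall c, dgc_comul (dgc_d c) =
    tensmap dgc_d idfun (dgc_comul c) + ktens dgc_gr 1 idfun dgc_d (dgc_comul c)
}.

Record dgComod (C : dgCoalg) := DgComod {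
  dgn_mod :> lmodType k;
  dgn_gr : grading dgn_mod;
  dgn_d : {linear dgn_mod -> dgn_mod};
  dgn_coact : {linear dgn_mod -> tens dgn_mod C};
  dgn_coact_deg : homdeg dgn_gr (tens_grading dgn_gr (dgc_gr C)) 0 dgn_coact;
  dgn_coassoc : forall n, tassoc (tensmap dgn_coact idfun (dgn_coact n)) =
    tensmap idfun (dgc_comul C) (dgn_coact n);
  dgn_counit : forall n,
    tens_lift (fun x c => dgc_counit C c *: x) (dgn_coact n) = n;
  dgn_d_deg : homdeg dgn_gr dgn_gr 1 dgn_d;
  dgn_dd : forall n, dgn_d (dgn_d n) = 0;
  dgn_coder : forall n, dgn_coact (dgn_d n) =
    tensmap dgn_d idfun (dgn_coact n)
      + ktens dgn_gr 1 idfun (dgc_d C) (dgn_coact n)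
}.

(* tau : C -> A of degree 1 with                                              *)
(*   c eta(-) + (m_1 tau + tau d_C) + m_2 (tau (x) tau) Delta = 0             *)
Definition isMC (C : dgCoalg) (A : cdgAlg) (tau : {linear C -> A}) : Prop :=
  homdeg (dgc_gr C) (cdga_gr A) 1 tau /\
  forall x : C,
    dgc_counit C x *: cdga_c A + (cdga_d A (tau x) + tau (dgc_d C x))
    + tens_lift (@cdga_mul A)
        (ktens (dgc_gr C) 1 tau tau (dgc_comul C x)) = 0.

Definition is_cdgHom (A : cdgAlg) (M M' : cdgMod A) (f : M -> M') : Prop :=
  [/\ linear f, homdeg (cdgm_gr M) (cdgm_gr M') 0 f,
      forall m a, f (cdgm_act m a) = cdgm_act (f m) a
    & forall m, f (cdgm_d M m) = cdgm_d M' (f m)].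

Record cdgHom (A : cdgAlg) (M M' : cdgMod A) := CdgHom {
  cdgHom_fun :> M -> M';
  cdgHomP : is_cdgHom cdgHom_fun
}.

Definition is_comodHom (C : dgCoalg) (N N' : dgComod C) (f : N -> N') : Prop :=
  [/\ linear f, homdeg (dgn_gr N) (dgn_gr N') 0 f,
      forall n, dgn_coact N' (f n) = tensmap f idfun (dgn_coact N n)
    & forall n, f (dgn_d N n) = dgn_d N' (f n)].

(* The degree 1 elements of S^{-1} Hom(N, M) are the degree 0 maps f; those   *)
(* tangent in tau satisfy d_M f - f d_N - m_2^M (f (x) tau) Delta_N = 0.      *)
Definition is_tangent (C : dgCoalg) (A : cdgAlg) (tau : {linear C -> A})
    (N : dgComod C) (M : cdgMod A) (f : N -> M) : Prop :=
  [/\ linear f, homdeg (dgn_gr N) (cdgm_gr M) 0 f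
    & forall n, cdgm_d M (f n) - f (dgn_d N n)
        - tens_lift (@cdgm_act A M) (ktens (dgn_gr N) 1 f tau (dgn_coact N n))
      = 0].

Section HomModules.
Variable C : dgCoalg.

Lemma homdeg_submod (V W : lmodType k) (G : grading V) (H : grading W) n :
  homdeg G H n (fun=> 0) /\ forall a (f g : V -> W),
    homdeg G H n f -> homdeg G H n g -> homdeg G H n (a *: f + g).
Proof.
split=> [p x _|a f g hf hg p x xp]; first by rewrite /homog linear0.
by rewrite /homog !fctE linearP (hf p x xp) (hg p x xp).
Qed.

Lemma linear_submod (V W : lmodType k) :
  linear (fun _ : V => 0 : W) /\ forall a (f g : V -> W),
    linear f -> linear g -> linear (a *: f + g).
Proof.
split=> [b x y|a f g fl gl b x y]; first by rewrite scaler0 addr0.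
rewrite !fctE fl gl !scalerDr !scalerA [a * b]mulrC -!addrA; congr (_ + _).
by rewrite addrCA.
Qed.

Lemma tens_lift_submod (U V W : lmodType k) (F : (U -> V -> W)) a
    (F1 F2 : U -> V -> W) t :
  (forall u v, F u v = a *: F1 u v + F2 u v) ->
  tens_lift F t = a *: tens_lift F1 t + tens_lift F2 t.
Proof.
move=> h; rewrite /tens_lift scaler_sumr -big_split /=.
by apply: eq_bigr => p _; rewrite h.
Qed.

Lemma ktens0 (U V U' V' : lmodType k) (G : grading U) q (g : V -> V') t :
  ktens G q (fun=> 0 : U') g t = 0.
Proof.
rewrite /ktens /tensmap /tens_lift big1// => p _.
by rewrite (lin0 ((tpure_bilin _ _).1 _)).
Qed.

Lemma ktensP (U V U' V' : lmodType k) (G : grading U) q a (f f' : U -> U')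
    (g : V -> V') t :
  ktens G q (a *: f + f') g t = a *: ktens G q f g t + ktens G q f' g t.
Proof.
by apply: tens_lift_submod => u v; exact: (tpure_bilin _ _).1.
Qed.

Variables N N' : dgComod C.

Definition comodHom_pred : {pred N -> N'} := fun f => `[< is_comodHom f >].

Lemma comodHom_submod : submod_closed comodHom_pred.
Proof.
split=> [|a f g /asboolP[fl fd fc fD] /asboolP[gl gd gc gD]]; apply/asboolP.
  split=> [||n|n].
  - exact: (linear_submod N N').1.
  - exact: (homdeg_submod (dgn_gr N) (dgn_gr N') 0).1.
  - rewrite /= linear0 /tensmap /tens_lift big1// => p _.
    by rewrite (lin0 ((tpure_bilin _ _).1 _)).
  - by rewrite /= linear0.
split=> [||n|n].
- exact: (linear_submod N N').2.
- exact: (homdeg_submod (dgn_gr N) (dgn_gr N') 0).2.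
- rewrite !fctE linearP fc gc; apply/esym/tens_lift_submod => u v.
  exact: (tpure_bilin _ _).1.
- by rewrite !fctE linearP fD gD.
Qed.

HB.instance Definition _ :=
  GRing.isSubmodClosed.Build k (N -> N') comodHom_pred comodHom_submod.

Record comodHom := ComodHom {
  comodHom_fun :> N -> N';
  comodHom_subproof : comodHom_fun \in comodHom_pred
}.
HB.instance Definition _ := [isSub for comodHom_fun].
HB.instance Definition _ := [Choice of comodHom by <:].
HB.instance Definition _ := [SubChoice_isSubLmodule of comodHom by <:].

Lemma comodHomP (f : comodHom) : is_comodHom f.
Proof. by apply/asboolP; case: f. Qed.

Variables (A : cdgAlg) (tau : {linear C -> A}) (M : cdgMod A).

Definition tangent_pred : {pred N -> M} := fun f => `[< is_tangent tau f >].

Lemma tangent_submod : submod_closed tangent_pred.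
Proof.
split=> [|a f g /asboolP hf /asboolP hg]; apply/asboolP; last first.
  move: hf hg => [fl fd fe] [gl gd ge]; split=> [||n].
  - exact: (linear_submod N M).2.
  - exact: (homdeg_submod (dgn_gr N) (cdgm_gr M) 0).2.
  rewrite !fctE linearP ktensP tens_lift_linear; last exact: cdgm_act_bilin.
  have E (x y z x' y' z' : M) : a *: x + x' - (a *: y + y') - (a *: z + z')
      = a *: (x - y - z) + (x' - y' - z').
    rewrite !scalerBr [RHS]addrACA -[in RHS]opprD; congr (_ - _).
    by rewrite [RHS]addrACA -opprD.
  by rewrite E fe ge scaler0 addr0.
split=> [||n].
- exact: (linear_submod N M).1.
- exact: (homdeg_submod (dgn_gr N) (cdgm_gr M) 0).1.
rewrite /= linear0 subr0 sub0r ktens0 (lin0 (tens_lift_linear _)) ?oppr0//.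
exact: cdgm_act_bilin.
Qed.

HB.instance Definition _ :=
  GRing.isSubmodClosed.Build k (N -> M) tangent_pred tangent_submod.

(* The k-module T_tau MC(S^{-1} Hom(N, M)).                                   *)
Record tangent := Tangent {
  tangent_fun :> N -> M;
  tangent_subproof : tangent_fun \in tangent_pred
}.
HB.instance Definition _ := [isSub for tangent_fun].
HB.instance Definition _ := [Choice of tangent by <:].
HB.instance Definition _ := [SubChoice_isSubLmodule of tangent by <:].

Lemma tangentP (f : tangent) : is_tangent tau f.
Proof. by apply/asboolP; case: f. Qed.

End HomModules.
End Structures.

Record category := Category {
  cat_obj :> Type;
  cat_hom : cat_obj -> cat_obj -> Type;
  cat_id : forall X, cat_hom X X;
  cat_comp : forall X Y Z, cat_hom Y Z -> cat_hom X Y -> cat_hom X Z;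
  cat_compA : forall W X Y Z (h : cat_hom Y Z) (g : cat_hom X Y)
    (f : cat_hom W X), cat_comp h (cat_comp g f) = cat_comp (cat_comp h g) f;
  cat_comp1f : forall X Y (f : cat_hom X Y), cat_comp (cat_id Y) f = f;
  cat_compf1 : forall X Y (f : cat_hom X Y), cat_comp f (cat_id X) = f
}.

Definition opcat (D : category) : category :=
  @Category D (fun X Y => cat_hom Y X) (@cat_id D)
    (fun X Y Z g f => cat_comp f g)
    (fun W X Y Z h g f => esym (cat_compA f g h))
    (fun X Y f => cat_compf1 f) (fun X Y f => cat_comp1f f).

Record functor (D E : category) := Functor {
  fobj :> D -> E;
  fmap : forall X Y, cat_hom X Y -> cat_hom (fobj X) (fobj Y);
  fmap_id : forall X, fmap (cat_id X) = cat_id (fobj X);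
  fmap_comp : forall X Y Z (g : cat_hom Y Z) (f : cat_hom X Y),
    fmap (cat_comp g f) = cat_comp (fmap g) (fmap f)
}.

Record natTrans (D E : category) (F G : functor D E) := NatTrans {
  nt_app :> forall X, cat_hom (F X) (G X);
  nt_nat : forall X Y (f : cat_hom X Y),
    cat_comp (nt_app Y) (fmap F f) = cat_comp (fmap G f) (nt_app X)
}.

Definition is_iso (D : category) (X Y : D) (f : cat_hom X Y) : Prop :=
  exists g : cat_hom Y X, cat_comp g f = cat_id X /\ cat_comp f g = cat_id Y.

Definition is_natIso (D E : category) (F G : functor D E) (e : natTrans F G) :=
  forall X, is_iso (e X).

Lemma linear_eq (k : comPzRingType) (U V : lmodType k) (f g : {linear U -> V}) :
  f =1 g -> f = g.
Proof.
move=> /funext fg; case: f g fg => [f [[f1] [f2] ]] [g [[g1] [g2]]] /= fg.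
subst g; congr GRing.Linear.Pack.
by rewrite (Prop_irrelevance f1 g1) (Prop_irrelevance f2 g2).
Qed.

Section Categories.
Variable k : comPzRingType.

Definition modcat : category :=
  @Category (lmodType k) (fun U V => {linear U -> V})
    (fun U => idfun : {linear U -> U})
    (fun U V W (g : {linear V -> W}) (f : {linear U -> V}) =>
      g \o f : {linear U -> W})
    ltac:(by move=> *; apply: linear_eq)
    ltac:(by move=> *; apply: linear_eq)
    ltac:(by move=> *; apply: linear_eq).

Section ModuleCategory.
Variable A : cdgAlg k.

Lemma cdgHom_eq (M M' : cdgMod A) (f g : cdgHom M M') : f =1 g -> f = g.
Proof.
case: f g => [f fP] [g gP] /= /funext fg; subst g.
congr CdgHom; exact: Prop_irrelevance.
Qed.

Lemma cdgHom_idP (M : cdgMod A) : is_cdgHom (idfun : M -> M).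
Proof. by split=> // p x; rewrite addr0. Qed.

Lemma cdgHom_compP (M M' M'' : cdgMod A) (g : cdgHom M' M'') (f : cdgHom M M') :
  is_cdgHom (g \o f).
Proof.
have [gl gd ga gD] := cdgHomP g; have [fl fd fa fD] := cdgHomP f.
split=> [a x y|p x xp|m a|m] /=; rewrite ?(fl, fa, fD, gl, ga, gD)//.
by rewrite -[p]addr0; apply: gd; exact: fd.
Qed.

Definition cdgCat : category :=
  @Category (cdgMod A) (@cdgHom k A)
    (fun M => CdgHom (cdgHom_idP M))
    (fun M M' M'' g f => CdgHom (cdgHom_compP g f))
    ltac:(by move=> *; apply: cdgHom_eq)
    ltac:(by move=> *; apply: cdgHom_eq)
    ltac:(by move=> *; apply: cdgHom_eq).

End ModuleCategory.

Section ComoduleCategory.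
Variable C : dgCoalg k.

Lemma comodHom_eq (N N' : dgComod C) (f g : comodHom N N') : f =1 g -> f = g.
Proof. by move=> /funext fg; apply: val_inj. Qed.

Lemma tensmap_id (U V : lmodType k) (t : tens U V) : tensmap idfun idfun t = t.
Proof.
have il (W : lmodType k) : linear (idfun : W -> W) by [].
apply: (tens_ext (f := tensmap idfun idfun) (g := idfun)) => //.
  exact: tensmap_linear.
by move=> u v; rewrite tensmapE.
Qed.

Lemma tensmap_comp1 (U U' U'' V : lmodType k) (g : U' -> U'') (f : U -> U')
    (t : tens U V) : linear g -> linear f ->
  tensmap (g \o f) idfun t = tensmap g idfun (tensmap f idfun t).
Proof.
move=> gl fl; have il : linear (idfun : V -> V) by [].
have cl : linear (g \o f) by move=> a x y /=; rewrite fl gl.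
apply: (tens_ext (g := tensmap g idfun \o tensmap f idfun)).
- exact: tensmap_linear.
- by move=> a x y; rewrite /= !tensmap_linear.
- by move=> u v /=; rewrite !tensmapE.
Qed.

Lemma comodHom_idP (N : dgComod C) :
  (idfun : N -> N) \in @comodHom_pred k C N N.
Proof.
by apply/asboolP; split=> // [p x|n]; rewrite ?addr0// tensmap_id.
Qed.

Lemma comodHom_compP (N N' N'' : dgComod C) (g : comodHom N' N'')
    (f : comodHom N N') : (g \o f) \in @comodHom_pred k C N N''.
Proof.
have [gl gd gc gD] := comodHomP g; have [fl fd fc fD] := comodHomP f.
apply/asboolP; split=> [a x y|p x xp|n|n] /=.
- by rewrite fl gl.
- by rewrite -[p]addr0; apply: gd; exact: fd.
- by rewrite gc fc -tensmap_comp1.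
- by rewrite fD gD.
Qed.

Definition comodHom_comp (N N' N'' : dgComod C) (g : comodHom N' N'')
  (f : comodHom N N') : comodHom N N'' := ComodHom (comodHom_compP g f).

Definition comCat : category :=
  @Category (dgComod C) (fun N N' => comodHom N N')
    (fun N => ComodHom (comodHom_idP N)) comodHom_comp
    ltac:(by move=> *; apply: comodHom_eq)
    ltac:(by move=> *; apply: comodHom_eq)
    ltac:(by move=> *; apply: comodHom_eq).

Definition comodHom_pre (N N' X : dgComod C) (h : comodHom N N')
  (f : comodHom N' X) : comodHom N X := comodHom_comp f h.

Lemma comodHom_pre_linear (N N' X : dgComod C) (h : comodHom N N') :
  linear (@comodHom_pre N N' X h).
Proof. by move=> a f g; apply: comodHom_eq. Qed.

HB.instance Definition _ (N N' X : dgComod C) (h : comodHom N N') :=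
  GRing.isLinear.Build k (comodHom N' X) (comodHom N X) _
    (@comodHom_pre N N' X h) (@comodHom_pre_linear N N' X h).

Definition comHomFunctor (X : dgComod C) : functor (opcat comCat) modcat :=
  @Functor (opcat comCat) modcat (fun N : dgComod C => comodHom N X)
    (fun N' N (h : comodHom N N') =>
       comodHom_pre h : {linear comodHom N' X -> comodHom N X})
    ltac:(by move=> N; apply: linear_eq => f; apply: comodHom_eq)
    ltac:(by move=> *; apply: linear_eq => f; apply: comodHom_eq).

Definition comodHom_post (N X X' : dgComod C) (h : comodHom X X')
  (f : comodHom N X) : comodHom N X' := comodHom_comp h f.

Lemma comodHom_post_linear (N X X' : dgComod C) (h : comodHom X X') :
  linear (@comodHom_post N X X' h).
Proof.
move=> a f g; apply: comodHom_eq => n; have [hl _ _ _] := comodHomP h.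
exact: hl.
Qed.

HB.instance Definition _ (N X X' : dgComod C) (h : comodHom X X') :=
  GRing.isLinear.Build k (comodHom N X) (comodHom N X') _
    (@comodHom_post N X X' h) (@comodHom_post_linear N X X' h).

Definition comHomPost (X X' : dgComod C) (h : comodHom X X') :
    natTrans (comHomFunctor X) (comHomFunctor X') :=
  @NatTrans _ _ (comHomFunctor X) (comHomFunctor X')
    (fun N : dgComod C =>
       comodHom_post h : {linear comodHom N X -> comodHom N X'})
    ltac:(by move=> *; apply: linear_eq => f; apply: comodHom_eq).

Definition representable (F : functor (opcat comCat) modcat) : Prop :=
  exists (X : dgComod C) (e : natTrans (comHomFunctor X) F), is_natIso e.

End ComoduleCategory.

Section Tangent.
Variables (C : dgCoalg k) (A : cdgAlg k) (tau : {linear C -> A}).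

Lemma tangent_eq (N : dgComod C) (M : cdgMod A) (f g : tangent N tau M) :
  f =1 g -> f = g.
Proof. by move=> /funext fg; apply: val_inj. Qed.

Lemma ktens_comp (N N' : dgComod C) (M : cdgMod A) (h : comodHom N N')
    (f : N' -> M) t : linear f ->
  ktens (dgn_gr N) 1 (f \o h) tau t =
  ktens (dgn_gr N') 1 f tau (tensmap h idfun t).
Proof.
move=> fl; have [hl hd _ _] := comodHomP h.
have il : linear (idfun : C -> C) by [].
have gl (V : lmodType k) (G : grading V) : linear (gsgn G 1).
  exact: gsgn_linear.
have kl (V W : lmodType k) (G : grading V) (g : V -> W) : linear g ->
    linear (g \o gsgn G 1).
  by move=> gg a x y; rewrite /= gl gg.
have hs n : h (gsgn (dgn_gr N) 1 n) = gsgn (dgn_gr N') 1 (h n).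
  rewrite [in LHS](gpr_sum (dgn_gr N) n) [in RHS](gpr_sum (dgn_gr N) n).
  have [B hB] := gpr_supp (dgn_gr N) n.
  rewrite (fsumE hB) (linS (gl _ _)) !(linS hl) (linS (gl _ _)).
  apply: eq_bigr => p _.
  have np : homog (dgn_gr N) p (gpr (dgn_gr N) p n).
    by rewrite /homog gpr_idem eqxx.
  rewrite (gsgnE _ np) (linZ hl); have := hd _ _ np; rewrite addr0 => hp.
  by rewrite (gsgnE _ hp).
rewrite /ktens; apply: (tens_ext
  (g := tensmap (f \o gsgn (dgn_gr N') 1) tau \o tensmap h idfun)).
- apply: tensmap_linear; last exact: linearP.
  by move=> a x y; rewrite /= gl hl fl.
- move=> a x y; rewrite /= tensmap_linear// tensmap_linear//.
    exact: kl.
  exact: linearP.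
move=> n c; rewrite /= !tensmapE//=; first by rewrite hs.
- exact: kl.
- exact: linearP.
- by move=> a x y; rewrite /= gl hl fl.
- exact: linearP.
Qed.

Lemma tangent_preP (N N' : dgComod C) (M : cdgMod A) (h : comodHom N N')
    (f : tangent N' tau M) : (f \o h) \in @tangent_pred k C N A tau M.
Proof.
have [hl hd hc hD] := comodHomP h; have [fl fd fe] := tangentP f.
apply/asboolP; split=> [a x y|p x xp|n] /=.
- by rewrite hl fl.
- by rewrite -[p]addr0; apply: fd; exact: hd.
- by rewrite ktens_comp// -hc hD fe.
Qed.

Definition tangent_pre (N N' : dgComod C) (M : cdgMod A) (h : comodHom N N')
  (f : tangent N' tau M) : tangent N tau M := Tangent (tangent_preP h f).

Lemma tangent_pre_linear (N N' : dgComod C) (M : cdgMod A) (h : comodHom N N') :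
  linear (@tangent_pre N N' M h).
Proof. by move=> a f g; apply: tangent_eq. Qed.

HB.instance Definition _ (N N' : dgComod C) (M : cdgMod A) (h : comodHom N N') :=
  GRing.isLinear.Build k (tangent N' tau M) (tangent N tau M) _
    (@tangent_pre N N' M h) (@tangent_pre_linear N N' M h).

Lemma tangent_postP (N : dgComod C) (M M' : cdgMod A) (g : cdgHom M M')
    (f : tangent N tau M) : (g \o f) \in @tangent_pred k C N A tau M'.
Proof.
have [gl gd ga gD] := cdgHomP g; have [fl fd fe] := tangentP f.
apply/asboolP; split=> [a x y|p x xp|n] /=.
- by rewrite fl gl.
- by rewrite -[p]addr0; apply: gd; exact: fd.
have gN x : g (- x) = - g x by rewrite -scaleN1r (linZ gl) scaleN1r.
have kl : linear (f \o gsgn (dgn_gr N) 1).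
  by move=> a x y; rewrite /= gsgn_linear fl.
have kl' : linear ((g \o f) \o gsgn (dgn_gr N) 1).
  by move=> a x y; rewrite /= gsgn_linear fl gl.
have tl : linear tau by exact: linearP.
suff -> : tens_lift (@cdgm_act k A M')
    (ktens (dgn_gr N) 1 (g \o f) tau (dgn_coact N n)) =
  g (tens_lift (@cdgm_act k A M)
    (ktens (dgn_gr N) 1 f tau (dgn_coact N n))).
  by rewrite -gD -!gN -!(linD gl) fe (lin0 gl).
have al (M0 : cdgMod A) : linear (tens_lift (@cdgm_act k A M0)).
  by apply: tens_lift_linear; exact: cdgm_act_bilin.
apply: (tens_ext
  (f := tens_lift (@cdgm_act k A M') \o ktens (dgn_gr N) 1 (g \o f) tau)
  (g := g \o (tens_lift (@cdgm_act k A M) \o ktens (dgn_gr N) 1 f tau))).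
- by move=> a x y; rewrite /= /ktens tensmap_linear// al.
- by move=> a x y; rewrite /= /ktens tensmap_linear// al gl.
move=> u c; rewrite /= /ktens !tensmapE// !tens_liftE ?ga//;
  exact: cdgm_act_bilin.
Qed.

Definition tangent_post (N : dgComod C) (M M' : cdgMod A) (g : cdgHom M M')
  (f : tangent N tau M) : tangent N tau M' := Tangent (tangent_postP g f).

Lemma tangent_post_linear (N : dgComod C) (M M' : cdgMod A) (g : cdgHom M M') :
  linear (@tangent_post N M M' g).
Proof.
move=> a f f'; apply: tangent_eq => n; have [gl _ _ _] := cdgHomP g.
exact: gl.
Qed.

HB.instance Definition _ (N : dgComod C) (M M' : cdgMod A) (g : cdgHom M M') :=
  GRing.isLinear.Build k (tangent N tau M) (tangent N tau M') _
    (@tangent_post N M M' g) (@tangent_post_linear N M M' g).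

Definition tangentFunctor (M : cdgMod A) : functor (opcat (comCat C)) modcat :=
  @Functor (opcat (comCat C)) modcat (fun N : dgComod C => tangent N tau M)
    (fun N' N (h : comodHom N N') =>
       tangent_pre h : {linear tangent N' tau M -> tangent N tau M})
    ltac:(by move=> N; apply: linear_eq => f; apply: tangent_eq)
    ltac:(by move=> *; apply: linear_eq => f; apply: tangent_eq).

Definition tangentPost (M M' : cdgMod A) (g : cdgHom M M') :
    natTrans (tangentFunctor M) (tangentFunctor M') :=
  @NatTrans _ _ (tangentFunctor M) (tangentFunctor M')
    (fun N : dgComod C =>
       tangent_post g : {linear tangent N tau M -> tangent N tau M'})
    ltac:(by move=> *; apply: linear_eq => f; apply: tangent_eq).

End Tangent.
End Categories.

(* Main.v *)
Require Import Defs.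
From HB Require Import structures.
From mathcomp Require Import all_boot all_algebra.
From mathcomp Require Import zify.
From mathcomp Require Import finmap boolp classical_sets fsbigop.

Set Implicit Arguments.
Unset Strict Implicit.
Unset Printing Implicit Defensive.
Import GRing.Theory.
Local Open Scope ring_scope.

(** The representing comodule is M (x) C with coaction M (x) Delta and a
differential twisted by tau. Everything rests on the cofreeness of M (x) C.
Write pi := M (x) eta for the projection M (x) C -> M. If rho is the coaction
of a comodule N, then h |-> pi h and f |-> (f (x) C) rho are inverse bijections
between the colinear maps N -> M (x) C and the linear maps N -> M
([cofree_liftK], [colinear_lift], [colinear_eq]).

Let s be the operator m |-> (-1)^|m| m on M, and let the twist be the map
m (x) c |-> s(m) tau(c) from M (x) C to M. The differential is
  D := d_M (x) C + s (x) d_C - (twist (x) C) (M (x) Delta).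
It is a coderivation, since the first two summands form one and the last is
colinear, and pi D = d_M pi - twist ([cofree_proj_bar_d]). Two identities can
therefore be checked after composition with pi:
- D D is colinear, because D is an odd coderivation, hence D D = 0 as soon as
  pi D D = 0. On m (x) c, the value of pi D D is minus the product of m with
  the left side of the Maurer-Cartan equation at c ([bar_dd]).
- For a colinear F : N -> M (x) C of degree 0, the defect F d_N - D F is
  colinear ([colinear_commutator]), and pi maps it to minus the left side of the
  tangent equation of f := pi F. So F is a chain map if and only if f is tangent
  ([bar_chain_mapP]).
Consequently F |-> pi F is an isomorphism from comodule maps onto tangent
vectors. The map induced by g : M -> M' is the one corresponding to g pi, and
functoriality and naturality follow from pi' (g (x) C) = g pi.

Signs are handled by the operators [gsgn _ 1] rather than by homogeneous
elements: this turns the Koszul rule, the Leibniz rules and the statement that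
odd maps anticommute with the sign into identities between linear maps, which
may be tested on arbitrary pure tensors. *)

(** * Linear maps *)

Section LinearMaps.
Variables (k : comPzRingType) (U V W : lmodType k).

Lemma lin_id : linear (idfun : U -> U). Proof. by []. Qed.

Lemma lin_zero : linear (fun _ : U => 0 : V).
Proof. by move=> a x y; rewrite scaler0 addr0. Qed.

Lemma lin_map (f : {linear U -> V}) : linear f. Proof. exact: linearP. Qed.

Lemma lin_comp (g : V -> W) (f : U -> V) :
  linear g -> linear f -> linear (g \o f).
Proof. by move=> gl fl a x y /=; rewrite fl gl. Qed.

Lemma lin_add (f g : U -> V) :
  linear f -> linear g -> linear (fun x => f x + g x).
Proof. by move=> fl gl a x y; rewrite fl gl scalerDr addrACA. Qed.

Lemma lin_opp (f : U -> V) : linear f -> linear (fun x => - f x).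
Proof. by move=> fl a x y; rewrite fl opprD scalerN. Qed.

Lemma lin_scale (a : k) (f : U -> V) : linear f -> linear (fun x => a *: f x).
Proof. by move=> fl b x y; rewrite fl scalerDr !scalerA mulrC. Qed.

Lemma linN (f : U -> V) : linear f -> {morph f : x / - x}.
Proof. by move=> fl x; rewrite -scaleN1r (linZ fl) scaleN1r. Qed.

Lemma tpure_linr (u : U) : linear (@tpure k U V u).
Proof. exact: (tpure_bilin _ _).2. Qed.

Lemma tpure_linl (v : V) : linear ((@tpure k U V)^~ v).
Proof. exact: (tpure_bilin _ _).1. Qed.

End LinearMaps.

Lemma ktens_linear (k : comPzRingType) (U V U' V' : lmodType k)
    (G : grading U) q (f : U -> U') (g : V -> V') :
  linear f -> linear g -> linear (ktens G q f g).
Proof.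
move=> fl gl; apply: tensmap_linear => //; apply: lin_comp => //.
exact: gsgn_linear.
Qed.

(** The maps of tensor products are plain functions with a separate proof of
linearity; this database builds such proofs by following the syntax of the
map. The patterns keep [lin_add] and [lin_opp] from unfolding addition. *)
Create HintDb linearity.
Ltac solve_linear := solve [auto 20 with linearity nocore].
#[local] Hint Extern 0 (GRing.linear_for _ _) => solve_linear : core.
#[local] Hint Extern 1 (GRing.linear_for _ idfun) => exact: lin_id : linearity.
#[local] Hint Extern 1 (GRing.linear_for _ (fun x => x)) =>
  exact: lin_id : linearity.
#[local] Hint Extern 1 (GRing.linear_for _ (fun x => 0)) =>
  exact: lin_zero : linearity.
#[local] Hint Extern 1 (GRing.linear_for _ (GRing.Linear.sort _)) =>
  exact: lin_map : linearity.
#[local] Hint Extern 1 (GRing.linear_for _ (tpure _)) =>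
  exact: tpure_linr : linearity.
#[local] Hint Extern 1 (GRing.linear_for _ (fun x => tpure x _)) =>
  exact: tpure_linl : linearity.
#[local] Hint Extern 1 (GRing.linear_for _ (gsgn _ _)) =>
  exact: gsgn_linear : linearity.
#[local] Hint Extern 1 (GRing.linear_for _ (tensmap _ _)) =>
  apply: tensmap_linear : linearity.
#[local] Hint Extern 1 (GRing.linear_for _ (ktens _ _ _ _)) =>
  apply: ktens_linear : linearity.
#[local] Hint Extern 1 (GRing.linear_for _ (_ \o _)) =>
  apply: lin_comp : linearity.
#[local] Hint Extern 2 (GRing.linear_for _ (fun x => _ + _)) =>
  apply: lin_add : linearity.
#[local] Hint Extern 2 (GRing.linear_for _ (fun x => - _)) =>
  apply: lin_opp : linearity.
#[local] Hint Extern 2 (GRing.linear_for _ (fun x => _ *: _)) =>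
  apply: lin_scale : linearity.

(** * Maps between tensor products *)

Section TensorMaps.
Variable k : comPzRingType.

Lemma eq_tensmap (U V U' V' : lmodType k) (f f' : U -> U') (g g' : V -> V') t :
  f =1 f' -> g =1 g' -> tensmap f g t = tensmap f' g' t.
Proof. by move=> /funext -> /funext ->. Qed.

Lemma tensmap_comp (U U' U'' V V' V'' : lmodType k) (f' : U' -> U'')
    (f : U -> U') (g' : V' -> V'') (g : V -> V') (t : tens U V) :
  linear f' -> linear f -> linear g' -> linear g ->
  tensmap f' g' (tensmap f g t) = tensmap (f' \o f) (g' \o g) t.
Proof.
move=> f'l fl g'l gl; apply/esym.
apply: (tens_ext (g := tensmap f' g' \o tensmap f g)) => // u v /=.
by rewrite !tensmapE.
Qed.

Lemma tensmapDl (U V U' V' : lmodType k) (f f' : U -> U') (g : V -> V') t :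
  tensmap (fun u => f u + f' u) g t = tensmap f g t + tensmap f' g t.
Proof.
rewrite -[tensmap f g t]scale1r; apply: tens_lift_submod => u v.
by rewrite scale1r (linD (tpure_linl _)).
Qed.

Lemma tensmapNl (U V U' V' : lmodType k) (f : U -> U') (g : V -> V') t :
  linear f -> linear g -> tensmap (fun u => - f u) g t = - tensmap f g t.
Proof.
move=> fl gl.
apply: (tens_ext (f := tensmap _ g) (g := fun x => - tensmap f g x)) => // u v.
by rewrite !tensmapE// (linN (tpure_linl _)).
Qed.

Lemma tensmap0l (U V U' V' : lmodType k) (g : V -> V') (t : tens U V) :
  tensmap (fun=> 0 : U') g t = 0.
Proof.
rewrite /tensmap /tens_lift big1// => p _.
exact: (lin0 (tpure_linl _)).
Qed.

Lemma tensmap0r (U V U' V' : lmodType k) (f : U -> U') (t : tens U V) :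
  tensmap f (fun=> 0 : V') t = 0.
Proof.
rewrite /tensmap /tens_lift big1// => p _.
exact: (lin0 (tpure_linr _)).
Qed.

(** The inverse of the associativity isomorphism [tassoc]. *)
Definition tassocV (U V W : lmodType k) :
    tens U (tens V W) -> tens (tens U V) W :=
  tens_lift (fun u => tensmap (tpure u) idfun).

Lemma tassocV_bilin (U V W : lmodType k) :
  bilin (fun (u : U) => tensmap (@tpure k U V u) (idfun : W -> W)).
Proof.
split=> // t a u u'; apply: tens_lift_submod => v w.
by rewrite (tpure_linl v) (tpure_linl w).
Qed.

Lemma tassocV_linear (U V W : lmodType k) : linear (@tassocV U V W).
Proof. exact/tens_lift_linear/tassocV_bilin. Qed.

Lemma tassocVE (U V W : lmodType k) (u : U) (t : tens V W) :
  tassocV (tpure u t) = tensmap (tpure u) idfun t.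
Proof. by rewrite /tassocV tens_liftE//; exact: tassocV_bilin. Qed.

#[local] Hint Extern 1 (GRing.linear_for _ _) =>
  exact: tassocV_linear : linearity.

Let tassoc_bilin1 (U V W : lmodType k) (w : W) :
  bilin (fun (u : U) (v : V) => tpure u (tpure v w)).
Proof.
by split=> // u; exact: (lin_comp (tpure_linr u)).
Qed.

Lemma tassoc_bilin (U V W : lmodType k) :
  bilin (fun x (w : W) =>
    tens_lift (fun (u : U) (v : V) => tpure u (tpure v w)) x).
Proof.
split=> [w|x]; first exact/tens_lift_linear/tassoc_bilin1.
move=> a w w'; apply: tens_lift_submod => u v.
by rewrite (tpure_linr v) (tpure_linr u).
Qed.

Lemma tassoc_linear (U V W : lmodType k) : linear (@tassoc k U V W).
Proof. exact/tens_lift_linear/tassoc_bilin. Qed.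

#[local] Hint Extern 1 (GRing.linear_for _ _) =>
  exact: tassoc_linear : linearity.

Lemma tassocE (U V W : lmodType k) (u : U) (v : V) (w : W) :
  tassoc (tpure (tpure u v) w) = tpure u (tpure v w).
Proof.
rewrite /tassoc tens_liftE; last exact: tassoc_bilin.
by rewrite tens_liftE//; exact: tassoc_bilin1.
Qed.

Lemma tens_ext3 (U V W X : lmodType k) (f g : tens (tens U V) W -> X) :
  linear f -> linear g ->
  (forall u v w, f (tpure (tpure u v) w) = g (tpure (tpure u v) w)) -> f =1 g.
Proof.
move=> fl gl fg; apply: tens_ext => // t w.
rewrite -[LHS]/((f \o (fun x => tpure x w)) t).
rewrite -[RHS]/((g \o (fun x => tpure x w)) t).
by apply: tens_ext => // u v; exact: fg.
Qed.

Lemma tassocK (U V W : lmodType k) : cancel (@tassoc k U V W) (@tassocV U V W).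
Proof.
apply: (tens_ext3 (f := @tassocV U V W \o @tassoc k U V W) (g := idfun)) => //.
by move=> u v w /=; rewrite tassocE tassocVE tensmapE.
Qed.

Lemma tassoc_nat (U U' V V' W W' : lmodType k) (f : U -> U') (g : V -> V')
    (h : W -> W') t : linear f -> linear g -> linear h ->
  tassoc (tensmap (tensmap f g) h t) = tensmap f (tensmap g h) (tassoc t).
Proof.
move=> fl gl hl.
apply: (tens_ext3 (f := @tassoc _ _ _ _ \o tensmap (tensmap f g) h)
  (g := tensmap f (tensmap g h) \o @tassoc _ _ _ _)) => // u v w /=.
by rewrite tassocE !tensmapE// tassocE.
Qed.

End TensorMaps.

(** * Gradings and signs *)

Section Gradings.
Variable k : comPzRingType.

Lemma ksignD p q : ksign k (p + q) = ksign k p * ksign k q.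
Proof.
have E r : ksign k r = ((-1) ^+ (odd `|r|%N))%R by rewrite signr_odd.
rewrite !E -signr_addb; congr (_ ^+ _).
case: p q => [m|m] [n|n]; lia.
Qed.

Lemma ksignK p : ksign k p * ksign k p = 1.
Proof. by rewrite -expr2 sqrr_sign. Qed.

Lemma homog_gpr (V : lmodType k) (G : grading V) p x : homog G p (gpr G p x).
Proof. by rewrite /homog gpr_idem eqxx. Qed.

Lemma homog_sum (V : lmodType k) (G : grading V) p (I : Type) (r : seq I)
    (F : I -> V) :
  (forall i, homog G p (F i)) -> homog G p (\sum_(i <- r) F i).
Proof.
by move=> h; rewrite /homog linear_sum; apply: eq_bigr => i _; exact: h.
Qed.

Lemma homog_scale (V : lmodType k) (G : grading V) p a x :
  homog G p x -> homog G p (a *: x).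
Proof. by move=> h; rewrite /homog linearZ /= h. Qed.

Lemma gpr_decomp (V : lmodType k) (G : grading V) x :
  exists A : {fset int}, x = \sum_(p <- A) gpr G p x.
Proof.
have [A hA] := gpr_supp G x; exists A.
by rewrite [LHS](gpr_sum G) (fsumE hA).
Qed.

Lemma homog_ext (V W : lmodType k) (G : grading V) (f g : V -> W) :
  linear f -> linear g -> (forall p x, homog G p x -> f x = g x) -> f =1 g.
Proof.
move=> fl gl fg x; have [A ->] := gpr_decomp G x; rewrite (linS fl) (linS gl).
by apply: eq_bigr => p _; apply: (fg p); exact: homog_gpr.
Qed.

(** The Koszul rule for a map of degree n passing a sign operator; the cases
n = 0 and n = 1 below are the ones that the bar construction uses. *)
Lemma gsgn_homdeg (V W : lmodType k) (G : grading V) (H : grading W) n q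
    (f : V -> W) x : linear f -> homdeg G H n f ->
  gsgn H q (f x) = ksign k (n * q) *: f (gsgn G q x).
Proof.
move=> fl fn.
apply: (homog_ext (G := G) (f := gsgn H q \o f)
  (g := fun y => ksign k (n * q) *: (f \o gsgn G q) y)) => //.
move=> p y yp /=; rewrite (gsgnE q yp) (gsgnE q (fn _ _ yp)) (linZ fl) scalerA.
by rewrite mulrDl ksignD mulrC.
Qed.

Lemma gsgn_even (V W : lmodType k) (G : grading V) (H : grading W)
    (f : V -> W) x : linear f -> homdeg G H 0 f ->
  gsgn H 1 (f x) = f (gsgn G 1 x).
Proof. by move=> fl f0; rewrite (gsgn_homdeg _ _ fl f0) scale1r. Qed.

Lemma gsgn_odd (V W : lmodType k) (G : grading V) (H : grading W)
    (f : V -> W) x : linear f -> homdeg G H 1 f ->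
  gsgn H 1 (f x) = - f (gsgn G 1 x).
Proof. by move=> fl f1; rewrite (gsgn_homdeg _ _ fl f1) scaleN1r. Qed.

Lemma gsgnK (V : lmodType k) (G : grading V) : involutive (gsgn G 1).
Proof.
apply: (homog_ext (G := G) (f := gsgn G 1 \o gsgn G 1) (g := idfun)) => //.
move=> p x xp /=; rewrite (gsgnE 1 xp) (linZ (gsgn_linear _ _)) (gsgnE 1 xp).
by rewrite scalerA ksignK scale1r.
Qed.

Lemma homdeg_id (V : lmodType k) (G : grading V) : homdeg G G 0 idfun.
Proof. by move=> p x; rewrite addr0. Qed.

Lemma homdeg_gsgn (V : lmodType k) (G : grading V) : homdeg G G 0 (gsgn G 1).
Proof.
by move=> p x xp; rewrite addr0 (gsgnE _ xp); exact: homog_scale.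
Qed.

Lemma homdeg_comp (U V W : lmodType k) (G : grading U) (H : grading V)
    (K : grading W) m n (g : V -> W) (f : U -> V) :
  homdeg H K n g -> homdeg G H m f -> homdeg G K (m + n) (g \o f).
Proof. by move=> gn fm p x /fm/gn; rewrite addrA. Qed.

Lemma homdeg_add (U V : lmodType k) (G : grading U) (H : grading V)
    n (f g : U -> V) :
  homdeg G H n f -> homdeg G H n g -> homdeg G H n (fun x => f x + g x).
Proof. by move=> fn gn p x xp; rewrite /homog linearD /= fn// gn. Qed.

Lemma homdeg_opp (U V : lmodType k) (G : grading U) (H : grading V)
    n (f : U -> V) :
  homdeg G H n f -> homdeg G H n (fun x => - f x).
Proof. by move=> fn p x xp; rewrite /homog linearN /= fn. Qed.

Variables (U V : lmodType k) (G : grading U) (H : grading V).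

Lemma homog_tpure p q u v : homog G p u -> homog H q v ->
  homog (tens_grading G H) (p + q) (tpure u v).
Proof.
move=> up vq; rewrite /homog /= (@tens_pr_pure _ _ _ _ _ [fset p]%fset).
  by rewrite big_seq_fset1 up [_ - _]addrC addKr vq.
by move=> r; rewrite in_fset1 -up gpr_idem => /negbTE ->.
Qed.

Lemma tens_homog_ext (W : lmodType k) (f g : tens U V -> W) :
  linear f -> linear g -> (forall p q u v, homog G p u -> homog H q v ->
    f (tpure u v) = g (tpure u v)) -> f =1 g.
Proof.
move=> fl gl fg; apply: tens_ext => // u v.
apply: (homog_ext (G := G) (f := f \o (fun x => tpure x v))
  (g := g \o (fun x => tpure x v))) => //.
move=> p x xp /=.
apply: (homog_ext (G := H) (f := f \o tpure x) (g := g \o tpure x)) => //.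
by move=> q y yq /=; exact: fg xp yq.
Qed.

(** The component of degree N of a tensor is a sum of pure tensors of
homogeneous elements, so the degree of a map can be tested on these. *)
Lemma tens_homdeg (W : lmodType k) (K : grading W) n (f : tens U V -> W) :
  linear f -> (forall p q u v, homog G p u -> homog H q v ->
    homog K (p + q + n) (f (tpure u v))) -> homdeg (tens_grading G H) K n f.
Proof.
move=> fl hf N t; rewrite /homog /= => <-.
have [A hA] := tens_pr_supp G H t.
rewrite /tens_pr (fsumE (hA N)) (linS fl); apply: homog_sum => p.
elim/tens_ind: t {hA} => [|x y hx hy|u v].
- by rewrite (lin0 (_ : linear (tensmap _ _)))// (lin0 fl) /homog linear0.
- rewrite (linD (_ : linear (tensmap _ _)))// (linD fl) /homog linearD /=.
  by rewrite hx hy.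
have := hf _ _ _ _ (homog_gpr G p u) (homog_gpr H (N - p) v).
by rewrite tensmapE// [p + _]addrC subrK.
Qed.

Lemma gsgn_tens : gsgn (tens_grading G H) 1 =1 tensmap (gsgn G 1) (gsgn H 1).
Proof.
apply: tens_homog_ext => // p q u v up vq.
rewrite tensmapE// (gsgnE _ (homog_tpure up vq)) (gsgnE _ up) (gsgnE _ vq).
rewrite (linZ (tpure_linr _)) (linZ (tpure_linl _)) scalerA.
by rewrite mulrDl ksignD mulrC.
Qed.

End Gradings.

Lemma homdeg_tensmap (k : comPzRingType) (U V U' V' : lmodType k)
    (G : grading U) (H : grading V) (G' : grading U') (H' : grading V')
    m n (f : U -> U') (g : V -> V') : linear f -> linear g ->
  homdeg G G' m f -> homdeg H H' n g ->
  homdeg (tens_grading G H) (tens_grading G' H') (m + n) (tensmap f g).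
Proof.
move=> fl gl fm gn; apply: tens_homdeg => // p q u v up vq.
by rewrite tensmapE// addrACA; apply: homog_tpure; [exact: fm|exact: gn].
Qed.

(** * Cofree comodules *)

Section Cofree.
Variables (k : comPzRingType) (C : dgCoalg k).
Implicit Types U V N : lmodType k.

(** The map V (x) eta; applied to a coaction, it also expresses the counit axiom
of a comodule. *)
Definition cofree_proj V : tens V C -> V :=
  tens_lift (fun v c => dgc_counit C c *: v).

Lemma cofree_proj_bilin V : bilin (fun (v : V) (c : C) => dgc_counit C c *: v).
Proof. by split=> [c|v] //; move=> a c c'; rewrite linearP scalerDl scalerA. Qed.

Lemma cofree_proj_linear V : linear (@cofree_proj V).
Proof. exact/tens_lift_linear/cofree_proj_bilin. Qed.

#[local] Hint Extern 1 (GRing.linear_for _ (@cofree_proj _)) =>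
  exact: cofree_proj_linear : linearity.

Lemma counitl_bilin : bilin (fun x y : C => dgc_counit C x *: y).
Proof. by split=> // y a x x'; rewrite linearP scalerDl scalerA. Qed.

Lemma cofree_projE V (v : V) (c : C) :
  cofree_proj (tpure v c) = dgc_counit C c *: v.
Proof. by rewrite /cofree_proj tens_liftE//; exact: cofree_proj_bilin. Qed.

Lemma cofree_proj_nat U V (f : U -> V) t : linear f ->
  cofree_proj (tensmap f idfun t) = f (cofree_proj t).
Proof.
move=> fl; apply: (tens_ext (f := @cofree_proj V \o tensmap f idfun)
  (g := f \o @cofree_proj U)) => // u c /=.
by rewrite tensmapE// !cofree_projE (linZ fl).
Qed.

Definition cofree_coact V (t : tens V C) : tens (tens V C) C :=
  tassocV (tensmap idfun (dgc_comul C) t).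

Lemma cofree_coact_linear V : linear (@cofree_coact V).
Proof.
by apply: (lin_comp (g := @tassocV _ _ _ _)) => //; exact: tassocV_linear.
Qed.

#[local] Hint Extern 1 (GRing.linear_for _ (@cofree_coact _)) =>
  exact: cofree_coact_linear : linearity.

Lemma cofree_coactE V (v : V) (c : C) :
  cofree_coact (tpure v c) = tensmap (tpure v) idfun (dgc_comul C c).
Proof. by rewrite /cofree_coact tensmapE// tassocVE. Qed.

Lemma cofree_coact_nat U V (f : U -> V) t : linear f ->
  cofree_coact (tensmap f idfun t) =
  tensmap (tensmap f idfun) idfun (cofree_coact t).
Proof.
move=> fl; apply: (tens_ext (f := @cofree_coact V \o tensmap f idfun)
  (g := tensmap (tensmap f idfun) idfun \o @cofree_coact U)) => // u c /=.
rewrite tensmapE// !cofree_coactE tensmap_comp//.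
by apply: eq_tensmap => // x /=; rewrite tensmapE.
Qed.

(** Up to reassociation, the two sides at v (x) c are v tensored with
(Delta (x) C) Delta c and v tensored with (C (x) Delta) Delta c. *)
Lemma cofree_coassoc V (t : tens V C) :
  tassoc (tensmap (@cofree_coact V) idfun (cofree_coact t)) =
  tensmap idfun (dgc_comul C) (cofree_coact t).
Proof.
apply: (tens_ext
  (f := @tassoc _ _ _ _ \o tensmap (@cofree_coact V) idfun \o @cofree_coact V)
  (g := tensmap idfun (dgc_comul C) \o @cofree_coact V)) => // [|v c /=].
  apply: lin_comp => //; apply: lin_comp => //; exact: tassoc_linear.
rewrite cofree_coactE !tensmap_comp//.
transitivity (tassoc (tensmap (tensmap (tpure v) idfun) idfun
    (tensmap (dgc_comul C) idfun (dgc_comul C c)))).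
  rewrite tensmap_comp//; congr tassoc; apply: eq_tensmap => // x /=.
  by rewrite cofree_coactE.
rewrite tassoc_nat// dgc_coassoc tensmap_comp//.
by apply: eq_tensmap => // x; exact: tensmap_id.
Qed.

Lemma cofree_counit V (t : tens V C) : cofree_proj (cofree_coact t) = t.
Proof.
apply: (tens_ext (f := @cofree_proj _ \o @cofree_coact V) (g := idfun)) => //.
move=> v c /=; rewrite cofree_coactE cofree_proj_nat//.
by congr tpure; exact: dgc_counitr.
Qed.

(** The left counit axiom of C. It makes a colinear map recoverable from its
projection. *)
Lemma cofree_proj_coact V (t : tens V C) :
  tensmap (@cofree_proj V) idfun (cofree_coact t) = t.
Proof.
apply: (tens_ext (f := tensmap (@cofree_proj V) idfun \o @cofree_coact V)
  (g := idfun)) => // v c /=.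
rewrite cofree_coactE tensmap_comp//.
rewrite -[in RHS](dgc_counitl c).
have bb := counitl_bilin.
apply: (tens_ext (f := tensmap (@cofree_proj V \o tpure v) idfun)
  (g := tpure v \o tens_lift (fun x y => dgc_counit C x *: y))) => //.
  by apply: lin_comp => //; exact: tens_lift_linear.
move=> x y /=; rewrite tensmapE//= tens_liftE// cofree_projE.
by rewrite (linZ (tpure_linl _)) (linZ (tpure_linr _)).
Qed.

(** Coactions of C on a module, forgetting gradings and differentials. *)
Definition is_coaction N (rho : N -> tens N C) : Prop :=
  [/\ linear rho,
      forall n, tassoc (tensmap rho idfun (rho n)) =
        tensmap idfun (dgc_comul C) (rho n)
    & forall n, cofree_proj (rho n) = n].

Lemma cofree_coaction V : is_coaction (@cofree_coact V).
Proof.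
by split=> //; [exact: cofree_coassoc|exact: cofree_counit].
Qed.

Lemma comod_coaction (N : dgComod C) : is_coaction (dgn_coact N).
Proof. by split=> //; [exact: dgn_coassoc|exact: dgn_counit]. Qed.

Section Universal.
Variables (N V : lmodType k) (rho : N -> tens N C).
Hypothesis rhoP : is_coaction rho.

Definition colinear (h : N -> tens V C) : Prop :=
  forall n, cofree_coact (h n) = tensmap h idfun (rho n).

Lemma colinear_zero : colinear (fun=> 0).
Proof. by move=> n; rewrite tensmap0l (lin0 (@cofree_coact_linear _)). Qed.

Definition cofree_lift (f : N -> V) (n : N) : tens V C :=
  tensmap f idfun (rho n).

Lemma cofree_lift_linear f : linear f -> linear (cofree_lift f).
Proof.
by move=> fl; have [rl _ _] := rhoP; apply: (lin_comp (g := tensmap f idfun)).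
Qed.

Lemma cofree_lift_colinear f : linear f -> colinear (cofree_lift f).
Proof.
have [rl rA _] := rhoP => fl n; rewrite /cofree_lift cofree_coact_nat//.
by rewrite /cofree_coact -rA tassocK tensmap_comp.
Qed.

Lemma cofree_liftK f n : linear f -> cofree_proj (cofree_lift f n) = f n.
Proof. by have [_ _ r1] := rhoP => fl; rewrite cofree_proj_nat// r1. Qed.

(** h = (pi (x) C) (coaction of V (x) C) h = (pi (x) C) (h (x) C) rho. *)
Lemma colinear_lift h n : linear h -> colinear h ->
  cofree_lift (@cofree_proj V \o h) n = h n.
Proof.
by move=> hl hc; rewrite -[RHS]cofree_proj_coact hc tensmap_comp.
Qed.

Lemma colinear_eq h h' : linear h -> colinear h -> linear h' -> colinear h' ->
  (forall n, cofree_proj (h n) = cofree_proj (h' n)) -> h =1 h'.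
Proof.
move=> hl hc hl' hc' e n; rewrite -colinear_lift// -[RHS]colinear_lift//.
exact: eq_tensmap.
Qed.

End Universal.

(** * Coderivations *)

Section Coderivations.
Variables (N : lmodType k) (G : grading N) (rho : N -> tens N C) (d : N -> N).

Definition coderivation : Prop :=
  [/\ linear d, homdeg G G 1 d
    & forall n, rho (d n) =
        tensmap d idfun (rho n) + ktens G 1 idfun (dgc_d C) (rho n)].

(** In the square of d (x) C + s (x) d_C, where s is the sign of N, the cross
terms d s (x) d_C and s d (x) d_C cancel because d is odd, and the last term
vanishes with d_C d_C. *)
Lemma coderivation_square : linear rho -> coderivation ->
  forall n, rho (d (d n)) = tensmap (d \o d) idfun (rho n).
Proof.
move=> rl [dl d1 dr] n; have kl : linear (ktens G 1 idfun (dgc_d C)) by [].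
have tl : linear (tensmap d (idfun : C -> C)) by [].
rewrite dr dr (linD tl) (linD kl) /ktens !tensmap_comp// -!addrA.
rewrite [X in _ + X = _](_ : _ = 0) ?addr0//.
rewrite [X in _ + (_ + X)](_ : _ = 0).
  rewrite addr0 -[X in X + _ = 0]opprK -tensmapNl//.
  rewrite (@eq_tensmap _ _ _ _ _ _ (gsgn G 1 \o d) _ (dgc_d C)) ?addNr//.
  move=> x /=.
  by rewrite (gsgn_odd _ dl d1).
rewrite (@eq_tensmap _ _ _ _ _ _ (gsgn G 1 \o gsgn G 1) _ (fun=> 0))//.
  exact: tensmap0r.
by move=> c /=; exact: dgc_dd.
Qed.

End Coderivations.

Lemma dgn_coderivation (N : dgComod C) :
  coderivation (dgn_gr N) (dgn_coact N) (dgn_d N).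
Proof. by split=> //; [exact: dgn_d_deg|exact: dgn_coder]. Qed.

(** F is even, hence commutes with the signs, so the terms in d_C of the two
coderivations cancel. *)
Lemma colinear_commutator (N V : lmodType k) (G : grading N)
    (H : grading (tens V C)) (rho : N -> tens N C) (d : N -> N)
    (D : tens V C -> tens V C) (F : N -> tens V C) :
  coderivation G rho d -> coderivation H (@cofree_coact V) D ->
  linear F -> homdeg G H 0 F -> colinear rho F ->
  colinear rho (fun n => F (d n) - D (F n)).
Proof.
move=> [dl d1 dr] [Dl D1 Dr] Fl F0 Fc n.
rewrite (linD (@cofree_coact_linear _)) (linN (@cofree_coact_linear _)).
have tl : linear (tensmap F (idfun : C -> C)) by [].
rewrite Dr !Fc dr (linD tl) /ktens !tensmap_comp//.
rewrite (@eq_tensmap _ _ _ _ _ ((idfun \o gsgn H 1) \o F)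
  (F \o (idfun \o gsgn G 1)) _ (dgc_d C \o idfun))//.
  rewrite opprD addrACA subrr addr0 tensmapDl; congr (_ + _).
  by rewrite -tensmapNl.
by move=> x /=; rewrite (gsgn_even _ Fl F0).
Qed.

(** Applying the counit to the right factor of the coderivation rule gives
s(c') eta(d c'') = 0 in Sweedler notation. As s is invertible, the sign can be
removed, and the counit applied to c' leaves eta(d c) = 0. *)
Lemma counit_d (c : C) : dgc_counit C (dgc_d C c) = 0.
Proof.
pose S := gsgn (dgc_gr C) 1.
pose Z (t : tens C C) := cofree_proj (tensmap idfun (dgc_d C) t).
have SZ t : cofree_proj (ktens (dgc_gr C) 1 idfun (dgc_d C) t) = S (Z t).
  by rewrite /S /Z -(cofree_proj_nat _ (gsgn_linear _ _)) /ktens tensmap_comp.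
have Z0 : Z (dgc_comul C c) = 0.
  rewrite -[LHS](gsgnK (dgc_gr C)) -/(S (Z _)) -SZ.
  have := dgc_counitr (dgc_d C c); rewrite -/(cofree_proj _) dgc_coder.
  rewrite (linD (@cofree_proj_linear _)) cofree_proj_nat//.
  rewrite [cofree_proj (dgc_comul C c)]dgc_counitr => /(canRL (addKr _)) ->.
  by rewrite addNr /S (lin0 (gsgn_linear _ _)).
have bb := counitl_bilin.
rewrite -[c](dgc_counitl c) -[RHS](linear0 (dgc_counit C)) -Z0.
apply: (tens_ext (f := dgc_counit C \o dgc_d C \o tens_lift
    (fun x y : C => dgc_counit C x *: y))
  (g := dgc_counit C \o @cofree_proj C \o tensmap idfun (dgc_d C))) => //.
  by apply: lin_comp => //; exact: tens_lift_linear.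
move=> x y /=; rewrite tens_liftE// tensmapE// cofree_projE !linearZ /=.
exact: mulrC.
Qed.

Section TensorDifferential.
Variables (V : lmodType k) (G : grading V) (d : V -> V).
Hypothesis dl : linear d.

(** For d = d_M, the part of the bar differential that does not involve tau. *)
Definition cofree_d (t : tens V C) : tens V C :=
  tensmap d idfun t + ktens G 1 idfun (dgc_d C) t.

Lemma cofree_d_linear : linear cofree_d.
Proof. exact: lin_add. Qed.

Lemma cofree_dE v c : cofree_d (tpure v c) =
  tpure (d v) c + tpure (gsgn G 1 v) (dgc_d C c).
Proof. by rewrite /cofree_d /ktens !tensmapE. Qed.

Lemma cofree_d_coact t : cofree_coact (cofree_d t) =
  tensmap cofree_d idfun (cofree_coact t) +
  ktens (tens_grading G (dgc_gr C)) 1 idfun (dgc_d C) (cofree_coact t).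
Proof.
have Dl := cofree_d_linear.
apply: (tens_ext (f := @cofree_coact V \o cofree_d)
  (g := fun t => (tensmap cofree_d idfun \o @cofree_coact V) t +
    (ktens (tens_grading G (dgc_gr C)) 1 idfun (dgc_d C)
      \o @cofree_coact V) t)).
- by [].
- by [].
move=> v c /=; rewrite cofree_dE (linD (@cofree_coact_linear _)) !cofree_coactE.
have tl : linear (tensmap (@tpure k V C (gsgn G 1 v)) (idfun : C -> C)) by [].
rewrite dgc_coder (linD tl) addrA /ktens !tensmap_comp//; congr (_ + _).
  by rewrite -tensmapDl; apply: eq_tensmap => // x /=; rewrite cofree_dE.
by apply: eq_tensmap => // x /=; rewrite gsgn_tens tensmapE.
Qed.

Lemma cofree_proj_d t : cofree_proj (cofree_d t) = d (cofree_proj t).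
Proof.
apply: (tens_ext (f := @cofree_proj V \o cofree_d) (g := d \o @cofree_proj V)).
- by apply: lin_comp => //; exact: cofree_d_linear.
- by [].
move=> v c /=; rewrite cofree_dE (linD (@cofree_proj_linear _)) !cofree_projE.
by rewrite counit_d scale0r addr0 (linZ dl).
Qed.

End TensorDifferential.

Lemma cofree_proj_deg (V : lmodType k) (G : grading V) :
  homdeg (tens_grading G (dgc_gr C)) G 0 (@cofree_proj V).
Proof.
apply: tens_homdeg => // p q v c vp cq; rewrite cofree_projE addr0.
have [->|q0] := eqVneq q 0; first by rewrite addr0; exact: homog_scale.
by rewrite (dgc_counit_deg cq q0) scale0r /homog linear0.
Qed.

Lemma cofree_coact_deg (V : lmodType k) (G : grading V) :
  homdeg (tens_grading G (dgc_gr C))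
    (tens_grading (tens_grading G (dgc_gr C)) (dgc_gr C)) 0 (@cofree_coact V).
Proof.
apply: tens_homdeg => // p q v c vp cq; rewrite cofree_coactE addr0.
have pd : homdeg (dgc_gr C) (tens_grading G (dgc_gr C)) p (tpure v).
  by move=> r x xr; rewrite addrC; exact: homog_tpure.
have := homdeg_tensmap (tpure_linr v) (@lin_id _ C) pd
  (@homdeg_id _ _ (dgc_gr C)).
rewrite addr0 => td; have := td _ _ (dgc_comul_deg cq).
by rewrite addr0 addrC.
Qed.

Lemma cofree_d_deg (V : lmodType k) (G : grading V) (d : V -> V) :
  linear d -> homdeg G G 1 d ->
  homdeg (tens_grading G (dgc_gr C)) (tens_grading G (dgc_gr C)) 1
    (cofree_d G d).
Proof.
move=> dl d1; apply: homdeg_add.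
  exact: (homdeg_tensmap (n := 0) dl _ d1 (@homdeg_id _ _ _)).
apply: (homdeg_tensmap (m := 0) (n := 1)) => //; last exact: dgc_d_deg.
exact: homdeg_gsgn.
Qed.

Lemma cofree_lift_deg (N V : lmodType k) (G : grading N) (H : grading V) n
    (rho : N -> tens N C) (f : N -> V) : linear f ->
  homdeg G (tens_grading G (dgc_gr C)) 0 rho -> homdeg G H n f ->
  homdeg G (tens_grading H (dgc_gr C)) n (cofree_lift rho f).
Proof.
move=> fl r0 fn; rewrite -[n]add0r; apply: (homdeg_comp (n := n) _ r0).
rewrite -[n]addr0; apply: homdeg_tensmap => //; exact: homdeg_id.
Qed.

HB.instance Definition _ (V : lmodType k) :=
  GRing.isLinear.Build k (tens V C) (tens (tens V C) C) _ (@cofree_coact V)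
    (@cofree_coact_linear V).

(** * The bar construction *)

Section Bar.
Variables (A : cdgAlg k) (tau : {linear C -> A}).
Hypothesis tauMC : isMC tau.

Lemma act_gsgn (M : cdgMod A) m a :
  gsgn (cdgm_gr M) 1 (cdgm_act m a) =
  cdgm_act (gsgn (cdgm_gr M) 1 m) (gsgn (cdga_gr A) 1 a).
Proof.
have [al ar] := cdgm_act_bilin M.
apply: (homog_ext (G := cdgm_gr M)
  (f := gsgn (cdgm_gr M) 1 \o (cdgm_act (c := M))^~ a)
  (g := (cdgm_act (c := M))^~ (gsgn (cdga_gr A) 1 a)
    \o gsgn (cdgm_gr M) 1)) => //.
move=> p {}m mp /=.
apply: (homog_ext (G := cdga_gr A) (f := gsgn (cdgm_gr M) 1 \o cdgm_act m)
  (g := cdgm_act (gsgn (cdgm_gr M) 1 m) \o gsgn (cdga_gr A) 1)) => //.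
move=> q {}a aq /=; rewrite (gsgnE _ (cdgm_act_deg mp aq)) (gsgnE _ mp).
rewrite (gsgnE _ aq) (linZ (ar _)) (linZ (al _)) scalerA.
by rewrite mulrDl ksignD mulrC.
Qed.

Lemma act_leibniz (M : cdgMod A) m a :
  cdgm_d M (cdgm_act m a) = cdgm_act (cdgm_d M m) a +
    cdgm_act (gsgn (cdgm_gr M) 1 m) (cdga_d A a).
Proof.
have [al ar] := cdgm_act_bilin M.
apply: (homog_ext (G := cdgm_gr M)
  (f := cdgm_d M \o (cdgm_act (c := M))^~ a)
  (g := fun m => ((cdgm_act (c := M))^~ a \o cdgm_d M) m +
    ((cdgm_act (c := M))^~ (cdga_d A a) \o gsgn (cdgm_gr M) 1) m)) => //.
move=> p {}m mp /=; rewrite (cdgm_leibniz _ mp) (gsgnE _ mp) mulr1.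
by rewrite (linZ (al _)).
Qed.

Section Module.
Variable M : cdgMod A.
Local Notation sM := (gsgn (cdgm_gr M) 1).

(** m (x) c |-> s(m) tau(c); see [twistE]. *)
Definition twist (t : tens M C) : M :=
  tens_lift (@cdgm_act k A M) (ktens (cdgm_gr M) 1 idfun tau t).

Lemma act_lift_linear : linear (tens_lift (@cdgm_act k A M)).
Proof. exact/tens_lift_linear/cdgm_act_bilin. Qed.

Lemma twist_linear : linear twist.
Proof. exact: (lin_comp act_lift_linear). Qed.

Lemma twistE m c : twist (tpure m c) = cdgm_act (sM m) (tau c).
Proof.
by rewrite /twist /ktens tensmapE// tens_liftE//; exact: cdgm_act_bilin.
Qed.

#[local] Hint Extern 1 (GRing.linear_for _ twist) =>
  exact: twist_linear : linearity.

Lemma twist_deg :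
  homdeg (tens_grading (cdgm_gr M) (dgc_gr C)) (cdgm_gr M) 1 twist.
Proof.
apply: tens_homdeg => // p q m c mp cq; rewrite twistE -addrA.
apply: cdgm_act_deg; last exact: tauMC.1.
by have := homdeg_gsgn mp; rewrite addr0.
Qed.

(** The last term of the tangent equation of f is the twist of the lift of f. *)
Lemma twist_map (V : lmodType k) (G : grading V) (f : V -> M) t : linear f ->
  homdeg G (cdgm_gr M) 0 f ->
  twist (tensmap f idfun t) = tens_lift (@cdgm_act k A M) (ktens G 1 f tau t).
Proof.
move=> fl f0; rewrite /twist /ktens tensmap_comp//; congr tens_lift.
by apply: eq_tensmap => // v /=; rewrite (gsgn_even _ fl f0).
Qed.

Definition bar_d (t : tens M C) : tens M C :=
  cofree_d (cdgm_gr M) (cdgm_d M) t - cofree_lift (@cofree_coact M) twist t.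

Let lift_linear : linear (cofree_lift (@cofree_coact M) twist).
Proof. exact: (cofree_lift_linear (cofree_coaction _)). Qed.

Lemma bar_d_linear : linear bar_d.
Proof.
apply: lin_add; first exact: cofree_d_linear.
exact/lin_opp/lift_linear.
Qed.

#[local] Hint Extern 1 (GRing.linear_for _ bar_d) =>
  exact: bar_d_linear : linearity.

Lemma bar_d_deg : homdeg (tens_grading (cdgm_gr M) (dgc_gr C))
  (tens_grading (cdgm_gr M) (dgc_gr C)) 1 bar_d.
Proof.
apply: homdeg_add; first by apply: cofree_d_deg => //; exact: cdgm_d_deg.
apply: homdeg_opp; apply: cofree_lift_deg => //.
  exact: cofree_coact_deg.
exact: twist_deg.
Qed.

Lemma bar_d_coder t : cofree_coact (bar_d t) =
  tensmap bar_d idfun (cofree_coact t) +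
  ktens (tens_grading (cdgm_gr M) (dgc_gr C)) 1 idfun (dgc_d C)
    (cofree_coact t).
Proof.
have Dl := cofree_d_linear (cdgm_gr M) (lin_map (cdgm_d M)).
rewrite /bar_d linearB /= cofree_d_coact//.
rewrite (tensmapDl (cofree_d _ _) (fun x => - cofree_lift _ _ x)) tensmapNl//.
by rewrite (cofree_lift_colinear (cofree_coaction _))// addrAC.
Qed.

Lemma bar_coderivation : coderivation
  (tens_grading (cdgm_gr M) (dgc_gr C)) (@cofree_coact M) bar_d.
Proof. by split; [exact: bar_d_linear|exact: bar_d_deg|exact: bar_d_coder]. Qed.

Lemma cofree_proj_bar_d t :
  cofree_proj (bar_d t) = cdgm_d M (cofree_proj t) - twist t.
Proof.
rewrite /bar_d (linD (@cofree_proj_linear _)).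
rewrite (linN (@cofree_proj_linear _)) cofree_proj_d//.
by rewrite (cofree_liftK (cofree_coaction _)).
Qed.

(** In Sweedler notation the left side is s(s(m) tau(c')) tau(c''), which is
m s(tau(c')) tau(c''); as tau is odd, s(tau(c')) = - tau(s(c')), and
tau(s(c')) tau(c'') is the Koszul-signed product of tau with itself. *)
Lemma twist_square m c :
  twist (cofree_lift (@cofree_coact M) twist (tpure m c)) =
  - cdgm_act m (tens_lift (@cdga_mul k A)
      (ktens (dgc_gr C) 1 tau tau (dgc_comul C c))).
Proof.
have [al ar] := cdgm_act_bilin M; have [ml mr] := cdga_mul_bilin A.
rewrite /cofree_lift cofree_coactE tensmap_comp//.
have mll : linear (tens_lift (@cdga_mul k A)).
  exact/tens_lift_linear/cdga_mul_bilin.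
apply: (tens_ext (f := twist \o tensmap (twist \o tpure m) (idfun \o idfun))
  (g := fun t => - ((cdgm_act m \o tens_lift (@cdga_mul k A) \o
     ktens (dgc_gr C) 1 tau tau) t))) => //.
move=> x y /=; rewrite /ktens !tensmapE//= twistE twistE act_gsgn gsgnK.
rewrite tens_liftE; last by split.
rewrite cdgm_actA (gsgn_odd _ _ tauMC.1)//.
by rewrite (linN (ml _)) (linN (ar _)).
Qed.

(** D D is colinear, so it suffices that pi D D vanishes. *)
Lemma bar_dd t : bar_d (bar_d t) = 0.
Proof.
have [al ar] := cdgm_act_bilin M.
have c0 := colinear_zero M (@cofree_coact M).
apply: (colinear_eq (rho := @cofree_coact M) (h := bar_d \o bar_d)
  (h' := fun=> 0)) => // [|{c0}{}t /=].
  exact: (coderivation_square (@cofree_coact_linear M) bar_coderivation).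
rewrite (lin0 (@cofree_proj_linear _)).
apply: (tens_ext (f := @cofree_proj M \o bar_d \o bar_d) (g := fun=> 0)) => //.
move=> m c /=; rewrite !cofree_proj_bar_d linearB /=.
rewrite /bar_d cofree_dE//.
rewrite (linD twist_linear) (linD twist_linear).
rewrite (linN twist_linear) twist_square !twistE gsgnK cofree_projE !linearZ /=.
rewrite cdgm_dd act_leibniz gsgnK (gsgn_odd _ (lin_map _) (@cdgm_d_deg _ _ M)).
rewrite (linN (al _)) opprK scalerN -(linZ (ar _)).
have := congr1 (cdgm_act m) (tauMC.2 c).
rewrite (lin0 (ar _)) !(linD (ar _)) => e.
(* P is the curvature term, R and S come from d tau and tau d, T from the square
   of tau; the two terms Q contain d_M m and cancel. *)
have E (P Q R S T : M) : - P - (Q + R) - (- Q + S + T) = - (P + (R + S) + T).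
  by rewrite -[- Q + S + T]addrA [Q + R]addrC !opprD opprK !addrA subrK.
by rewrite E e oppr0.
Qed.

HB.instance Definition _ :=
  GRing.isLinear.Build k (tens M C) (tens M C) _ bar_d bar_d_linear.

Definition barComod : dgComod C :=
  @DgComod k C (tens M C) (tens_grading (cdgm_gr M) (dgc_gr C))
    (bar_d : {linear tens M C -> tens M C})
    (@cofree_coact M : {linear tens M C -> tens (tens M C) C})
    (@cofree_coact_deg M (cdgm_gr M)) (@cofree_coassoc M) (@cofree_counit M)
    bar_d_deg bar_dd bar_d_coder.

(** pi maps the colinear map F d_N - D F to minus the left side of the tangent
equation. *)
Lemma bar_chain_mapP (N : dgComod C) (F : N -> tens M C) : linear F ->
  homdeg (dgn_gr N) (tens_grading (cdgm_gr M) (dgc_gr C)) 0 F ->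
  colinear (dgn_coact N) F ->
  (forall n, F (dgn_d N n) = bar_d (F n)) <->
  (forall n, cdgm_d M (cofree_proj (F n)) - cofree_proj (F (dgn_d N n))
     - twist (F n) = 0).
Proof.
move=> Fl F0 Fc; split=> [FD n|e n].
  by rewrite FD cofree_proj_bar_d subKr subrr.
apply/eqP; rewrite -subr_eq0; apply/eqP.
have pl := @cofree_proj_linear M.
suff h0 : (fun n => F (dgn_d N n) - bar_d (F n)) =1 (fun=> 0) by exact: h0.
apply: (colinear_eq (rho := dgn_coact N)) => // [|||{}n].
- apply: lin_add; first exact: (lin_comp Fl).
  by apply: lin_opp; exact: (lin_comp bar_d_linear).
- exact: (colinear_commutator (dgn_coderivation N) bar_coderivation).
- exact: colinear_zero.
rewrite (linD pl) (linN pl) cofree_proj_bar_d (lin0 pl).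
by rewrite -[RHS]oppr0 -(e n) !opprB addrCA.
Qed.

Lemma proj_tangentP (N : dgComod C) (F : comodHom N barComod) :
  (@cofree_proj M \o F) \in @tangent_pred k C N A tau M.
Proof.
have [Fl F0 Fc FD] := comodHomP F; have pl := @cofree_proj_linear M.
have pF : linear (@cofree_proj M \o F) by exact: lin_comp.
have pF0 : homdeg (dgn_gr N) (cdgm_gr M) 0 (@cofree_proj M \o F).
  exact: (homdeg_comp (@cofree_proj_deg _ _) F0).
apply/asboolP; split=> // n.
rewrite -(twist_map _ pF)// -/(cofree_lift _ _ _) colinear_lift//.
exact: (iffLR (bar_chain_mapP Fl F0 Fc) FD n).
Qed.

Definition bar_to_tangent (N : dgComod C) (F : comodHom N barComod) :
  tangent N tau M := Tangent (proj_tangentP F).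

Lemma lift_comodHomP (N : dgComod C) (f : tangent N tau M) :
  cofree_lift (dgn_coact N) f \in @comodHom_pred k C N barComod.
Proof.
have [fl f0 fe] := tangentP f; have rP := comod_coaction N.
have Ll : linear (cofree_lift (dgn_coact N) f) by exact: cofree_lift_linear.
have L0 : homdeg (dgn_gr N) (tens_grading (cdgm_gr M) (dgc_gr C)) 0
    (cofree_lift (dgn_coact N) f).
  by apply: cofree_lift_deg => //; exact: dgn_coact_deg.
have Lc : colinear (dgn_coact N) (cofree_lift (dgn_coact N) f).
  exact: cofree_lift_colinear.
apply/asboolP; split=> //; apply/(bar_chain_mapP Ll L0 Lc) => n.
by rewrite !(cofree_liftK rP)// /cofree_lift (twist_map _ fl f0).
Qed.

Definition tangent_to_bar (N : dgComod C) (f : tangent N tau M) :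
  comodHom N barComod := ComodHom (lift_comodHomP f).

Lemma bar_to_tangentK (N : dgComod C) :
  cancel (@bar_to_tangent N) (@tangent_to_bar N).
Proof.
move=> F; apply: comodHom_eq => n; have [Fl _ Fc _] := comodHomP F.
exact: (colinear_lift (rho := dgn_coact N)).
Qed.

Lemma tangent_to_barK (N : dgComod C) :
  cancel (@tangent_to_bar N) (@bar_to_tangent N).
Proof.
move=> f; apply: tangent_eq => n; have [fl _ _] := tangentP f.
exact: (cofree_liftK (comod_coaction N)).
Qed.

Lemma bar_to_tangent_linear (N : dgComod C) : linear (@bar_to_tangent N).
Proof. by move=> a F F'; apply: tangent_eq => n; exact: cofree_proj_linear. Qed.

Lemma tangent_to_bar_linear (N : dgComod C) : linear (@tangent_to_bar N).
Proof.
by move=> a f f'; apply: (can_inj (@bar_to_tangentK N));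
  rewrite bar_to_tangent_linear !tangent_to_barK.
Qed.

HB.instance Definition _ (N : dgComod C) :=
  GRing.isLinear.Build k (comodHom N barComod) (tangent N tau M) _
    (@bar_to_tangent N) (@bar_to_tangent_linear N).

HB.instance Definition _ (N : dgComod C) :=
  GRing.isLinear.Build k (tangent N tau M) (comodHom N barComod) _
    (@tangent_to_bar N) (@tangent_to_bar_linear N).

Definition barTrans : natTrans (comHomFunctor barComod) (tangentFunctor tau M) :=
  @NatTrans _ _ (comHomFunctor barComod) (tangentFunctor tau M)
    (fun N : dgComod C =>
      @bar_to_tangent N : {linear comodHom N barComod -> tangent N tau M})
    ltac:(by move=> *; apply: linear_eq => f; apply: tangent_eq).

Lemma barTrans_iso : is_natIso barTrans.
Proof.
move=> N.
exists (@tangent_to_bar N : {linear tangent N tau M -> comodHom N barComod}).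
split; apply: linear_eq => f /=.
  exact: bar_to_tangentK.
exact: tangent_to_barK.
Qed.

End Module.

Lemma bar_hom_ext (N : dgComod C) (M : cdgMod A)
    (F F' : comodHom N (barComod M)) :
  (forall n, cofree_proj (F n) = cofree_proj (F' n)) -> F = F'.
Proof.
move=> e; apply: (can_inj (@bar_to_tangentK M N)).
exact: tangent_eq.
Qed.

(** The comodule map g (x) C, obtained from the tangent vector g pi; this spares
the verification that it is a comodule map. *)
Definition barHom (M M' : cdgMod A) (g : cdgHom M M') :
    comodHom (barComod M) (barComod M') :=
  tangent_to_bar (tangent_post g
    (bar_to_tangent (cat_id (barComod M : comCat C)))).

Lemma barHomE (M M' : cdgMod A) (g : cdgHom M M') (t : tens M C) :
  cofree_proj (barHom g t) = g (cofree_proj t).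
Proof.
rewrite /barHom; set f := tangent_post g _.
by rewrite -[LHS]/(bar_to_tangent (tangent_to_bar f) t) tangent_to_barK.
Qed.

Lemma barHom_id (M : cdgCat A) :
  barHom (cat_id M) = cat_id (barComod M : comCat C).
Proof. by apply: bar_hom_ext => t; rewrite barHomE. Qed.

Lemma barHom_comp (M M' M'' : cdgCat A) (g : cat_hom M' M'') (f : cat_hom M M') :
  barHom (cat_comp g f) = comodHom_comp (barHom g) (barHom f).
Proof.
apply: bar_hom_ext => t.
by rewrite -[RHS]/(cofree_proj (barHom g (barHom f t))) !barHomE.
Qed.

Definition barFunctor : functor (cdgCat A) (comCat C) :=
  @Functor (cdgCat A) (comCat C) barComod barHom barHom_id barHom_comp.

Lemma barTrans_nat (M M' : cdgMod A) (g : cdgHom M M') (N : dgComod C) :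
  cat_comp (barTrans M' N) (comHomPost (fmap barFunctor g) N) =
  cat_comp (tangentPost tau g N) (barTrans M N).
Proof.
apply: linear_eq => F; apply: tangent_eq => n.
exact: barHomE.
Qed.

End Bar.
End Cofree.

Theorem mainTheorem8 (k : comPzRingType) (A : cdgAlg k) (C : dgCoalg k)
    (tau : {linear C -> A}) (tauMC : isMC tau) :
  (forall M : cdgMod A, representable (tangentFunctor tau M)) /\
  exists (bar : functor (cdgCat A) (comCat C))
         (phi : forall M : cdgMod A,
            natTrans (comHomFunctor (bar M)) (tangentFunctor tau M)),
    (forall M : cdgMod A, is_natIso (phi M)) /\
    (forall (M M' : cdgMod A) (g : cdgHom M M') (N : dgComod C),
       cat_comp (phi M' N) (comHomPost (fmap bar g) N) =
       cat_comp (tangentPost tau g N) (phi M N)).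
Proof.
split=> [M|].
  by exists (barComod tauMC M), (barTrans tauMC M); exact: barTrans_iso.
exists (barFunctor tauMC), (barTrans tauMC); split=> [M|M M' g N].
  exact: barTrans_iso.
exact: barTrans_nat.
Qed.
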